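(* Let $\theta\in(0,1)$ be irrational with $w(\theta)=1$. Then $\mathcal U_\tau[\theta]=\mathbb T$ if $0<\tau<1$, $\mathcal U_\tau[\theta]=\{i\theta: i\ge1\}$ if $\tau>1$, and $\tfrac12\le\dim_H\mathcal U_1[\theta]\le1$.
   Context: $\mathbb T=\mathbb R/\mathbb Z$; points identified with fractional parts. $\|t\|$ is the distance from $t$ to the nearest integer. For irrational $\theta$, $w(\theta)=\sup\{s>0:\liminf_{j\to\infty}j^s\|j\theta\|=0\}$. For $\tau>0$, $\mathcal U_\tau[\theta]$ is the set of $y\in\mathbb T$ such that there exists $Q_0$ with: for every real $Q\ge Q_0$ there is an integer $1\le n\le Q$ with $\|n\theta-y\|<Q^{-\tau}$. *)

(* Defs.v *)
From Stdlib Require Import Reals Lra.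
Open Scope R_scope.

(* fractional part {t} in [0,1): floor t = up t - 1 *)
Definition frac (t : R) : R := t - (IZR (up t) - 1).

Definition dnint (t : R) : R := Rmin (frac t) (1 - frac t).

Definition irrational (x : R) : Prop :=
  ~ exists (p q : Z), q <> 0%Z /\ x = IZR p / IZR q.

(* liminf_{j->oo} j^s ||j theta|| = 0  (sequence is nonnegative) *)
Definition liminf_zero (theta s : R) : Prop :=
  forall eps, eps > 0 -> forall N : nat, exists j : nat,
    (N <= j)%nat /\ (1 <= j)%nat /\ Rpower (INR j) s * dnint (INR j * theta) < eps.

Definition irr_exponent_is (theta w : R) : Prop :=
  is_lub (fun s => s > 0 /\ liminf_zero theta s) w.

(* U_tau[theta], as a predicate on representatives y in [0,1) of T *)
Definition U (tau theta : R) (y : R) : Prop :=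
  exists Q0 : R, forall Q : R, Q >= Q0 ->
    exists n : nat, (1 <= n)%nat /\ INR n <= Q /\
      dnint (INR n * theta - y) < Rpower Q (- tau).

Definition in_T (y : R) : Prop := 0 <= y < 1.

(* H^s(E) = 0 : for all delta, eps > 0 there is a countable delta-cover of E
   (by intervals, which in R is no loss since every set lies in an interval
   of the same diameter) with sum of diam^s at most eps. *)
Definition hnull (s : R) (E : R -> Prop) : Prop :=
  forall delta eps, delta > 0 -> eps > 0 ->
    exists a b : nat -> R,
      (forall k, a k < b k <= a k + delta) /\
      (forall x, E x -> exists k, a k <= x <= b k) /\
      (forall N, sum_f_R0 (fun k => Rpower (b k - a k) s) N <= eps).

Definition is_hdim (E : R -> Prop) (d : R) : Prop :=
  (forall s, 0 <= s -> hnull s E -> d <= s) /\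
  (forall d', (forall s, 0 <= s -> hnull s E -> d' <= s) -> d' <= d).

(* Main.v *)
Require Import Defs.
From Stdlib Require Import Reals.
From Stdlib Require Import Lra Lia ZArith IndefiniteDescription Classical.
Open Scope R_scope.

(** Let [q_k] be the denominators of the convergents of [theta] and [d_k = ||q_k theta||].  Exponent
    [1] means [||j theta|| >= c j^(-1-delta)] for every [delta > 0], so [q_(k+1)] is at most
    [q_k^(1+delta)] up to a constant.  For [tau < 1] the result follows because the multiples
    [n theta], [n <= q_k], are [2 / q_k]-dense.  For [tau > 1] the approximant of [y] cannot change
    as [Q] grows, since two different ones would make [||j theta||] too small.

    For [tau = 1] the upper bound is trivial, and the lower bound comes from a Cantor set.  A node of
    level [k] is the interval between a multiple [n theta] and [(n + q_k) theta], [n < q_(k+1)], of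
    length [d_k].  Adding [q_(k+1)] repeatedly cuts it into [A_k] intervals of level [k+1] and one of
    level [k+2], [A_k] being the partial quotient.  We keep the short one and the first [c_k] long
    ones, where [c_k] is small enough that every kept point is within [1 / Q] of an end of the current
    gap until that gap is cut, and large enough (about [sqrt A_k]) that the number [g_k] of kept
    nodes, [g_(k+2) = c_k g_(k+1) + g_k], satisfies [g_k^2 >= q_k].  A cover whose [s]-sums are small
    for some [s < 1/2] then misses a point: charge each covering interval to the nodes of its scale
    and descend along nodes whose charge stays below their share of the leaves. *)

(* Here [q0 = q_k], [q1 = q_(k+1)], and [q1 - M] bounds the index [n] of a node of level [k].  The gap
   with ends [n] and [n + q0 + i q1] has length [d_k - i d_(k+1)] and is cut at a time at most [T].
   The first alternative puts the kept part of the gap within [1 / T] of its end [n + q0 + i q1]; the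
   second makes the gap no longer than [2 / T], a condition affine in [d_(k+2) / d_(k+1)] and hence
   tested at the values [0] and [1]. *)
Definition cond (A c : nat) (q0 q1 M : R) : Prop :=
  forall i, (i < c)%nat ->
    let T := q1 - M + q0 + (INR i + 1) * q1 in
    (INR c - INR i) * T <= INR A * q1 + q0 \/
    ((INR A - INR i) * T <= 2 * (INR A * q1 + q0) /\
     (INR A + 1 - INR i) * T <= 2 * ((INR A + 1) * q1 + q0)).

(* The last alternative occurs only after a partial quotient [1]: the slack [M] may then be too small
   to keep [sqrt A] long children, but the growth of [g] over two steps makes up for it. *)
Definition inv (q0 q1 M g0 g1 : R) : Prop :=
  (0 < q0 <= q1 /\ 0 <= M <= q1) /\
  (0 < g0 /\ 0 < g1 /\ q0 <= g0 * g0 /\ q1 <= g1 * g1) /\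
  (4 * q0 < q1 -> q1 <= 2 * M) /\
  (16 * q0 < q1 -> q1 + q0 <= 2 * M) /\
  (q0 <= 2 * M \/
   exists qp gp, 0 <= qp <= q0 /\ 0 <= gp /\ qp <= gp * gp /\
     q1 = q0 + qp /\ g1 = g0 + gp /\ q0 <= 4 * qp).

(** Bounds a product below by a geometric mean without square roots; it serves the cross term
    [2 c g0 g1] of [(c g1 + g0)^2]. *)
Lemma prod_lower (a b g h t : R) :
  0 <= g -> 0 <= h -> 0 <= a -> 0 <= b -> a <= g * g -> b <= h * h -> t * t <= a * b -> t <= g * h.
Proof.
  intros Hg Hh Ha Hb H1 H2 Ht.
  assert (a * b <= (g * g) * (h * h)) by (apply Rmult_le_compat; lra).
  assert (0 <= g * h) by (apply Rmult_le_pos; lra).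
  destruct (Rle_lt_dec t (g * h)) as [H3|H3]; [exact H3|].
  assert (g * h * (g * h) < t * t) by (apply Rmult_le_0_lt_compat; lra).
  nra.
Qed.

Lemma ceil_sqrt (A : nat) : (17 <= A)%nat -> exists c, (5 <= c)%nat /\ (A <= c * c)%nat /\ ((c - 1) * (c - 1) < A)%nat.
Proof.
  intros HA. induction A as [|A IH]; [lia|].
  destruct (Nat.eq_dec A 16) as [->|Hn].
  - exists 5%nat. lia.
  - destruct IH as [c (H5 & H1 & H2)]; [lia|].
    destruct (Nat.eq_dec A (c * c)) as [E|E].
    + exists (S c). split; [lia|split; [nia|]]. replace (S c - 1)%nat with c by lia. lia.
    + exists c. lia.
Qed.

Ltac check_cond_at i :=
  destruct i as [|i];
  [cbn [INR]; first [left; lra | right; split; lra] | first [exfalso; lia | check_cond_at i]].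

Ltac check_cond := let i := fresh "i" in intros i Hi; cbv zeta; check_cond_at i.

(** The natural [c] is the ceiling of [sqrt A], because then [(c g1)^2 >= A q1]. For some [A] among
    2, ..., 7 and 10 it is taken one lower in part of the cases, which eases [cond] and leaves a
    larger slack. The lost growth is recovered from the cross term, through a lower bound on
    [g0 * g1], or on [g0 * gp] after a partial quotient 1. *)
Lemma inv_step (A : nat) (q0 q1 M g0 g1 : R) :
  (1 <= A)%nat -> inv q0 q1 M g0 g1 ->
  exists c, (1 <= c <= A)%nat /\ cond A c q0 q1 M /\
    inv q1 (INR A * q1 + q0) (M + (INR A - INR c) * q1) g1 (INR c * g1 + g0).
Proof.
  intros HA (Hq & (Hg0 & Hg1 & Hq0 & Hq1) & H4 & H16 & Hmode).
  (* If [q1 <= 4 q0] then [q0 q1 >= (q1 / 2)^2]; with 16 in place of 4 the bound is [(q1 / 4)^2]. *)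
  assert (P4 : q1 <= 4 * q0 -> q1 / 2 <= g0 * g1) by
    (intros; apply (prod_lower q0 q1); try lra; nra).
  assert (P16 : q1 <= 16 * q0 -> q1 / 4 <= g0 * g1) by
    (intros; apply (prod_lower q0 q1); try lra; nra).
  assert (P0 : 0 < g0 * g1) by (apply Rmult_lt_0_compat; lra).
  (* [Build] reaches the first alternative of the last clause of [inv]; only [A = 1] has to bypass
     it. *)
  assert (Build : forall c, (1 <= c <= A)%nat -> cond A c q0 q1 M ->
     INR A * q1 + q0 <= (INR c * g1 + g0) * (INR c * g1 + g0) ->
     (4 * q1 < INR A * q1 + q0 -> INR A * q1 + q0 <= 2 * (M + (INR A - INR c) * q1)) ->
     (16 * q1 < INR A * q1 + q0 -> INR A * q1 + q0 + q1 <= 2 * (M + (INR A - INR c) * q1)) ->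
     q1 <= 2 * (M + (INR A - INR c) * q1) ->
     exists c, (1 <= c <= A)%nat /\ cond A c q0 q1 M /\
    inv q1 (INR A * q1 + q0) (M + (INR A - INR c) * q1) g1 (INR c * g1 + g0)).
  { intros c Hc C1 C2 C3 C4 C5. exists c. split; [exact Hc|split; [exact C1|]].
    assert (1 <= INR c) by (apply (le_INR 1); lia).
    assert (INR c <= INR A) by (apply le_INR; lia).
    assert (1 * q1 <= INR A * q1) by (apply Rmult_le_compat_r; lra).
    assert (0 <= (INR A - INR c) * q1) by (apply Rmult_le_pos; lra).
    assert (0 < INR c * g1) by (apply Rmult_lt_0_compat; lra).
    assert (1 * q1 <= INR c * q1) by (apply Rmult_le_compat_r; lra).
    repeat split; solve [lra | assumption | left; exact C5]. }
  destruct (le_lt_dec 17 A) as [HA17|HA17].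
  { destruct (ceil_sqrt A HA17) as [c (Hc5 & Hc1 & Hc2)].
    assert (Hcr : 5 <= INR c) by (apply (le_INR 5) in Hc5; cbn [INR] in Hc5; lra).
    assert (HAc : INR A <= INR c * INR c) by (rewrite <- mult_INR; apply le_INR; exact Hc1).
    assert (HcA : (INR c - 1) * (INR c - 1) + 1 <= INR A).
    { apply le_INR in Hc2. rewrite S_INR, mult_INR, minus_INR in Hc2 by lia.
      cbn [INR] in Hc2. lra. }
    assert (Hcc : 2 * INR c + 2 <= INR A) by nra.
    assert (Hmul : (2 * INR c + 2) * q1 <= INR A * q1) by (apply Rmult_le_compat_r; lra).
    assert (0 <= INR c * q1) by (apply Rmult_le_pos; lra).
    apply (Build c).
    - split; [lia|]. apply INR_le. lra.
    - intros i Hi. left.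
      assert (Hir : INR i + 1 <= INR c) by (rewrite <- S_INR; apply le_INR; lia).
      assert (Hi0 : 0 <= INR i) by apply pos_INR.
      (* [4 (c - i) (i + 3) = (c + 3)^2 - (c - 2 i - 3)^2], and [c >= 5] gives [(c + 3)^2 <= 4 ((c -
         1)^2 + 2) <= 4 (A + 1)]. *)
      assert ((INR c - INR i) * (INR i + 3) <= INR A + 1).
      { pose proof (Rle_0_sqr (INR c - 2 * INR i - 3)) as Hs. unfold Rsqr in Hs.
        assert (0 <= (INR c - 5) * INR c) by (apply Rmult_le_pos; lra).
        lra. }
      assert ((INR c - INR i) * (q1 - M + q0 + (INR i + 1) * q1) <=
              (INR c - INR i) * (q0 + (INR i + 2) * q1)) by (apply Rmult_le_compat_l; lra).
      assert ((INR c - INR i - 1) * q0 <= (INR c - INR i - 1) * q1) by (apply Rmult_le_compat_l; lra).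
      assert (((INR c - INR i) * (INR i + 3) - 1) * q1 <= INR A * q1) by (apply Rmult_le_compat_r; lra).
      lra.
    - assert (INR A * q1 <= (INR c * INR c) * (g1 * g1)) by (apply Rmult_le_compat; lra).
      assert (0 <= INR c * (g0 * g1)) by (apply Rmult_le_pos; lra).
      lra.
    - lra.
    - lra.
    - lra. }
  destruct (Nat.eq_dec A 1) as [->|N1].
  { exists 1%nat. split; [lia|]. split; [check_cond|].
    cbn [INR]. replace (1 * q1 + q0) with (q1 + q0) by ring.
    replace (M + (1 - 1) * q1) with M by ring. replace (1 * g1 + g0) with (g1 + g0) by ring.
    repeat split; try lra; try nra.
    (* Here [c = A], so the slack does not grow. If it is below [q1 / 2], then [H4] forces
       [q1 <= 4 q0], as the second alternative requires. *)
    destruct (Rle_lt_dec q1 (2 * M)) as [h|h]; [left; exact h|].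
    right. exists q0, g0. repeat split; lra. }
  destruct (Nat.eq_dec A 2) as [->|N2].
  { destruct (Rle_lt_dec q1 (4 * q0)) as [h|h].
    - specialize (P4 h). apply (Build 1%nat); cbn [INR]; try lia; try check_cond; try lra; try nra.
    - specialize (H4 h). apply (Build 2%nat); cbn [INR]; try lia; try check_cond; try lra; try nra. }
  destruct (Nat.eq_dec A 3) as [->|N3].
  { destruct Hmode as [h|(qp & gp & Hqp & Hgp & Hqg & -> & -> & h4)].
    - apply (Build 2%nat); cbn [INR]; try lia; try check_cond; try lra; try nra.
    - assert (qp <= g0 * gp) by (apply (prod_lower q0 qp); try lra; nra).
      apply (Build 1%nat); cbn [INR]; try lia; try check_cond; try lra; try nra. }
  destruct (Nat.eq_dec A 4) as [->|N4].
  { destruct Hmode as [h|(qp & gp & Hqp & Hgp & Hqg & -> & -> & h4)].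
    - apply (Build 2%nat); cbn [INR]; try lia; try check_cond; try lra; try nra.
    - assert ((q0 + 3 * qp) / 4 <= g0 * gp) by (apply (prod_lower q0 qp); try lra; nra).
      apply (Build 1%nat); cbn [INR]; try lia; try check_cond; try lra; try nra. }
  destruct (Nat.eq_dec A 5) as [->|N5].
  { destruct (Rle_lt_dec q1 (16 * q0)) as [h|h].
    - specialize (P16 h). apply (Build 2%nat); cbn [INR]; try lia; try check_cond; try lra; try nra.
    - specialize (H16 h). apply (Build 3%nat); cbn [INR]; try lia; try check_cond; try lra; try nra. }
  destruct (Nat.eq_dec A 6) as [->|N6].
  { destruct (Rle_lt_dec q1 (4 * q0)) as [h|h].
    - specialize (P4 h). apply (Build 2%nat); cbn [INR]; try lia; try check_cond; try lra; try nra.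
    - specialize (H4 h). apply (Build 3%nat); cbn [INR]; try lia; try check_cond; try lra; try nra. }
  destruct (Nat.eq_dec A 7) as [->|N7].
  { destruct Hmode as [h|(qp & gp & Hqp & Hgp & Hqg & -> & -> & h4)].
    - apply (Build 3%nat); cbn [INR]; try lia; try check_cond; try lra; try nra.
    - assert (qp <= g0 * gp) by (apply (prod_lower q0 qp); try lra; nra).
      apply (Build 2%nat); cbn [INR]; try lia; try check_cond; try lra; try nra. }
  destruct (Nat.eq_dec A 10) as [->|N10].
  { destruct (Rle_lt_dec q1 (16 * q0)) as [h|h].
    - specialize (P16 h). apply (Build 3%nat); cbn [INR]; try lia; try check_cond; try lra; try nra.
    - apply (Build 4%nat); cbn [INR]; try lia; try check_cond; try lra; try nra. }
  destruct (le_lt_dec A 9) as [h9|h9].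
  { assert (HA' : A = 8%nat \/ A = 9%nat) by lia.
    destruct HA' as [->| ->]; apply (Build 3%nat); cbn [INR]; try lia; try check_cond; try lra; try nra. }
  assert (HA' : A = 11%nat \/ A = 12%nat \/ A = 13%nat \/ A = 14%nat \/ A = 15%nat \/ A = 16%nat) by lia.
  destruct HA' as [->|[->|[->|[->|[->| ->]]]]]; apply (Build 4%nat); cbn [INR]; try lia; try check_cond; try lra; try nra.
Qed.

(** * Dependent choice and the distance to the nearest integer *)

Lemma dependent_choice_nat (X : Type) (P : nat -> X -> Prop) (R' : nat -> X -> X -> Prop) (x0 : X) :
  P 0%nat x0 ->
  (forall k x, P k x -> exists x', P (S k) x' /\ R' k x x') ->
  exists f : nat -> X, f 0%nat = x0 /\ forall k, P k (f k) /\ R' k (f k) (f (S k)).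
Proof.
  intros H0 Hs.
  (* Where [P] fails the successor defaults to [x] itself, so that the choice is total. *)
  assert (Hc : forall kx : nat * X, exists x',
    P (fst kx) (snd kx) -> P (S (fst kx)) x' /\ R' (fst kx) (snd kx) x').
  { intros [k x]; cbn. destruct (classic (P k x)) as [h|h].
    - destruct (Hs k x h) as [x' Hx']. exists x'. auto.
    - exists x. tauto. }
  apply functional_choice in Hc. destruct Hc as [h Hh].
  pose (f := fix f k := match k with O => x0 | S k => h (k, f k) end).
  assert (HP : forall k, P k (f k)).
  { induction k as [|k IH]; [exact H0|]. exact (proj1 (Hh (k, f k) IH)). }
  exists f. split; [reflexivity|]. intros k. split; [apply HP|].
  exact (proj2 (Hh (k, f k) (HP k))).
Qed.

Lemma frac_range (t : R) : 0 <= frac t < 1.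
Proof. unfold frac. pose proof (archimed t). lra. Qed.

Lemma dnint_pos (t : R) : 0 <= dnint t.
Proof. unfold dnint. pose proof (frac_range t). apply Rmin_glb; lra. Qed.

Lemma dnint_le (t : R) (p : Z) : dnint t <= Rabs (t - IZR p).
Proof.
  unfold dnint. pose proof (frac_range t) as Hf.
  assert (Ht : t = frac t + IZR (up t - 1)) by (unfold frac; rewrite minus_IZR; lra).
  set (u := (up t - 1)%Z) in *.
  destruct (Z_le_gt_dec p u) as [h|h].
  - apply IZR_le in h. eapply Rle_trans; [apply Rmin_l|].
    rewrite Rabs_right; lra.
  - assert (h' : (u + 1 <= p)%Z) by lia. apply IZR_le in h'. rewrite plus_IZR in h'.
    eapply Rle_trans; [apply Rmin_r|]. rewrite Rabs_left1; lra.
Qed.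

Lemma dnint_attained (t : R) : exists p : Z, dnint t = Rabs (t - IZR p).
Proof.
  pose proof (frac_range t) as Hf.
  assert (Ht : t = frac t + IZR (up t - 1)) by (unfold frac; rewrite minus_IZR; lra).
  unfold dnint, Rmin. destruct (Rle_dec (frac t) (1 - frac t)).
  - exists (up t - 1)%Z. rewrite Rabs_right; lra.
  - exists (up t)%Z. rewrite minus_IZR in Ht. rewrite Rabs_left1; lra.
Qed.

(** * Convergents and a choice of kept children at every level *)

(** No initial values are fixed, so that every tail of the sequence of convergents is again an
    instance. *)
Record convergents (theta : R) (q A : nat -> nat) (p : nat -> Z) (s d : nat -> R) : Prop := {
  cv_sign : forall k, s k = 1 \/ s k = -1;
  cv_alt : forall k, s (S k) = - s k;
  cv_err : forall k, INR (q k) * theta - IZR (p k) = s k * d k;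
  cv_pos : forall k, 0 < d k;
  cv_decr : forall k, d (S k) < d k;
  cv_d : forall k, d k = INR (A k) * d (S k) + d (S (S k));
  cv_q : forall k, q (S (S k)) = (A k * q (S k) + q k)%nat;
  cv_det : forall k, INR (q (S k)) * d k + INR (q k) * d (S k) = 1;
  cv_A : forall k, (1 <= A k)%nat
}.

Record selection (q A c : nat -> nat) (M g : nat -> R) : Prop := {
  sel_range : forall k, (1 <= c k <= A k)%nat;
  sel_cond : forall k, cond (A k) (c k) (INR (q k)) (INR (q (S k))) (M k);
  sel_inv : forall k, inv (INR (q k)) (INR (q (S k))) (M k) (g k) (g (S k));
  sel_M : forall k, M (S k) = M k + (INR (A k) - INR (c k)) * INR (q (S k));
  sel_g : forall k, g (S (S k)) = INR (c k) * g (S k) + g k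
}.

Lemma selection_exists (theta : R) q A p s d (M0 g0 g1 : R) :
  convergents theta q A p s d ->
  inv (INR (q 0%nat)) (INR (q 1%nat)) M0 g0 g1 ->
  exists c M g, selection q A c M g /\ M 0%nat = M0 /\ g 0%nat = g0 /\ g 1%nat = g1.
Proof.
  intros CV H0.
  (* The state at level [k] is the triple [(M k, g k, g (S k))]; the numbers [c k] are extracted
     afterwards. *)
  destruct (dependent_choice_nat (R * R * R)
    (fun k x => inv (INR (q k)) (INR (q (S k))) (fst (fst x)) (snd (fst x)) (snd x))
    (fun k x x' => exists c, (1 <= c <= A k)%nat /\
       cond (A k) c (INR (q k)) (INR (q (S k))) (fst (fst x)) /\
       x' = (fst (fst x) + (INR (A k) - INR c) * INR (q (S k)), snd x, INR c * snd x + snd (fst x)))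
    (M0, g0, g1) H0) as [f [Hf0 Hf]].
  { intros k [[M a] b]; cbn. intros Hi.
    destruct (inv_step (A k) _ _ _ _ _ (cv_A _ _ _ _ _ _ CV k) Hi) as [c (H1 & H2 & H3)].
    eexists (_, _, _). cbn. rewrite (cv_q _ _ _ _ _ _ CV k), plus_INR, mult_INR.
    split; [exact H3|]. exists c. auto. }
  assert (Hc : forall k, exists c, (1 <= c <= A k)%nat /\
       cond (A k) c (INR (q k)) (INR (q (S k))) (fst (fst (f k))) /\
       f (S k) = (fst (fst (f k)) + (INR (A k) - INR c) * INR (q (S k)), snd (f k),
         INR c * snd (f k) + snd (fst (f k)))) by (intros k; exact (proj2 (Hf k))).
  apply functional_choice in Hc. destruct Hc as [c Hc].
  assert (Hg : forall k, snd (fst (f (S k))) = snd (f k)).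
  { intros k. destruct (Hc k) as (_ & _ & ->). reflexivity. }
  exists c, (fun k => fst (fst (f k))), (fun k => snd (fst (f k))).
  split; [|cbv beta; rewrite (Hg 0%nat), Hf0; cbn; auto].
  split; intros k; try rewrite Hg; destruct (Hc k) as (h1 & h2 & h3).
  - exact h1.
  - exact h2.
  - exact (proj1 (Hf k)).
  - rewrite h3. reflexivity.
  - rewrite h3. reflexivity.
Qed.

(** * Nodes and the times at which their ends approximate *)

(** What [U 1 theta y] demands at the single time [Q]. The exponent is written [- (1)] to agree with
    [- tau] at [tau = 1]. *)
Definition approx (theta Q y : R) : Prop :=
  exists n : nat, (1 <= n)%nat /\ INR n <= Q /\ dnint (INR n * theta - y) < Rpower Q (- (1)).

(** [X] is a lift of [n theta] to the real line. The node stands for the interval from [X] to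
    [X + s k * d k], a lift of [(n + q k) theta]. *)
Definition node (theta : R) (q : nat -> nat) (M : nat -> R) (k n : nat) (X : R) : Prop :=
  (1 <= n)%nat /\ INR n <= INR (q (S k)) - M k /\ exists p : Z, X = INR n * theta - IZR p.

Lemma approx_intro (theta Q T y X : R) (n : nat) (p : Z) :
  (1 <= n)%nat -> INR n <= Q -> Q < T -> X = INR n * theta - IZR p ->
  Rabs (X - y) * T <= 1 -> approx theta Q y.
Proof.
  intros Hn HQ HT HX Hd. exists n. split; [exact Hn|split; [exact HQ|]].
  assert (HQ0 : 0 < Q) by (apply le_INR in Hn; cbn in Hn; lra).
  rewrite Rpower_Ropp, Rpower_1 by exact HQ0.
  eapply Rle_lt_trans; [apply (dnint_le _ p)|].
  replace (INR n * theta - y - IZR p) with (X - y) by lra.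
  apply Rle_lt_trans with (/ T).
  - apply Rmult_le_reg_r with T; [lra|]. rewrite Rinv_l; lra.
  - apply Rinv_lt_contravar; [apply Rmult_lt_0_compat; lra|exact HT].
Qed.

Lemma locate (a b Q : R) (j : nat) :
  a <= Q < a + INR j * b -> exists i, (i < j)%nat /\ a + INR i * b <= Q < a + (INR i + 1) * b.
Proof.
  induction j as [|j IH]; intros H.
  - cbn in H. lra.
  - rewrite S_INR in H. destruct (Rle_lt_dec (a + INR j * b) Q).
    + exists j. split; [lia|lra].
    + destruct IH as [i [h1 h2]]; [lra|]. exists i. split; [lia|exact h2].
Qed.

Lemma sign_abs (e t : R) : e = 1 \/ e = -1 -> Rabs t = Rabs (e * t).
Proof.
  intros [->| ->]; [f_equal; ring|]. rewrite <- Rabs_Ropp. f_equal. ring.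
Qed.

Section Nodes.
Context (theta : R) (q A c : nat -> nat) (p : nat -> Z) (s d M g : nat -> R).
Context (CV : convergents theta q A p s d) (SEL : selection q A c M g).

Let q_pos k : 0 < INR (q k).
Proof. destruct (sel_inv _ _ _ _ _ SEL k) as ((h & _) & _). lra. Qed.

(* The points that successively cut the node, approaching its end [n]. *)
Lemma candidate (k n i : nat) (X : R) : node theta q M k n X ->
  exists p', X + s k * d k + INR i * (s (S k) * d (S k)) =
    INR (n + q k + i * q (S k)) * theta - IZR p'.
Proof.
  intros (_ & _ & p0 & ->).
  exists (p0 + p k + Z.of_nat i * p (S k))%Z.
  rewrite !plus_INR, mult_INR, !plus_IZR, mult_IZR, <- INR_IZR_INZ.
  rewrite <- !(cv_err _ _ _ _ _ _ CV). ring.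
Qed.

(* [t] is the distance from [y] to the far end of the node. *)
Lemma approx_in_node (k n i : nat) (X y Q t : R) :
  node theta q M k n X ->
  t = d k - s k * (y - X) ->
  let T := INR n + INR (q k) + (INR i + 1) * INR (q (S k)) in
  INR n + INR (q k) + INR i * INR (q (S k)) <= Q < T ->
  (0 <= d k - t /\ (d k - t) * T <= 1) \/ (0 <= t - INR i * d (S k) /\ (t - INR i * d (S k)) * T <= 1) ->
  approx theta Q y.
Proof.
  intros Hn Ht T HQ [[h0 h]|[h0 h]].
  - destruct Hn as (h1 & _ & p0 & HX).
    apply (approx_intro theta Q T y X n p0); try tauto; try lra.
    + pose proof (q_pos k). pose proof (q_pos (S k)). pose proof (pos_INR i). nra.
    + rewrite (sign_abs (s k)) by apply (cv_sign _ _ _ _ _ _ CV).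
      rewrite Rabs_left1 by lra. replace (- (s k * (X - y))) with (d k - t) by lra. exact h.
  - destruct (candidate k n i X Hn) as [p' Hp'].
    apply (approx_intro theta Q T y (X + s k * d k + INR i * (s (S k) * d (S k))) (n + q k + i * q (S k)) p').
    + destruct Hn as (h1 & _); lia.
    + rewrite !plus_INR, mult_INR. lra.
    + lra.
    + exact Hp'.
    + rewrite (sign_abs (s k)) by apply (cv_sign _ _ _ _ _ _ CV).
      rewrite (cv_alt _ _ _ _ _ _ CV).
      replace (s k * (X + s k * d k + INR i * (- s k * d (S k)) - y)) with (t - INR i * d (S k)).
      * rewrite Rabs_right by lra. exact h.
      * destruct (cv_sign _ _ _ _ _ _ CV k) as [e|e]; rewrite Ht, e; ring.
Qed.

(** The period runs from the birth of the node to that of its long child [j]. While the gap has ends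
    [n] and [n + q_k + i q_(k+1)], the first alternative of [cond] makes the second end close enough
    to every kept point; under the second alternative the nearer end of the gap serves. *)
Lemma long_child_approx (k n j : nat) (X y Q : R) :
  node theta q M k n X -> (j < c k)%nat ->
  0 <= s k * (y - X) ->
  INR j * d (S k) <= d k - s k * (y - X) <= (INR j + 1) * d (S k) ->
  INR n + INR (q k) <= Q < INR n + INR (q k) + (INR j + 1) * INR (q (S k)) ->
  approx theta Q y.
Proof.
  intros Hn Hj Hu Ht HQ.
  rewrite <- S_INR in HQ.
  destruct (locate _ _ _ _ HQ) as [i [Hi HQi]].
  set (t := d k - s k * (y - X)) in *.
  apply (approx_in_node k n i X y Q t Hn eq_refl); [exact HQi|].
  set (T := INR n + INR (q k) + (INR i + 1) * INR (q (S k))).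
  set (T' := INR (q (S k)) - M k + INR (q k) + (INR i + 1) * INR (q (S k))).
  assert (HT : 0 < T <= T').
  { destruct Hn as (h1 & h2 & _). apply le_INR in h1. cbn in h1.
    pose proof (q_pos k). pose proof (q_pos (S k)). pose proof (pos_INR i). unfold T, T'. split; [nra|lra]. }
  pose proof (cv_pos _ _ _ _ _ _ CV (S k)) as Hd1. pose proof (cv_pos _ _ _ _ _ _ CV (S (S k))) as Hd2.
  pose proof (cv_d _ _ _ _ _ _ CV k) as Hd. pose proof (cv_decr _ _ _ _ _ _ CV (S k)) as Hdd.
  pose proof (cv_det _ _ _ _ _ _ CV k) as Hdet.
  assert (Hij : INR i <= INR j) by (apply le_INR; lia).
  assert (Hjc : INR j + 1 <= INR (c k)) by (rewrite <- S_INR; apply le_INR; lia).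
  assert (Hti : 0 <= t - INR i * d (S k)).
  { assert (INR i * d (S k) <= INR j * d (S k)) by (apply Rmult_le_compat_r; lra). lra. }
  assert (Hi' : (i < c k)%nat) by lia.
  destruct (sel_cond _ _ _ _ _ SEL k i Hi') as [L|[F0 F1]].
  - right. split; [exact Hti|].
    fold T' in L.
    assert (B1 : t - INR i * d (S k) <= (INR (c k) - INR i) * d (S k)).
    { assert ((INR j + 1) * d (S k) <= INR (c k) * d (S k)) by (apply Rmult_le_compat_r; lra). lra. }
    apply Rle_trans with ((INR (c k) - INR i) * d (S k) * T').
    + apply Rmult_le_compat; lra.
    + apply Rle_trans with (d (S k) * (INR (A k) * INR (q (S k)) + INR (q k))).
      * replace ((INR (c k) - INR i) * d (S k) * T') with (d (S k) * ((INR (c k) - INR i) * T')) by ring.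
        apply Rmult_le_compat_l; lra.
      * rewrite Hd in Hdet.
        assert (0 < INR (q (S k)) * d (S (S k))) by (apply Rmult_lt_0_compat; [apply q_pos|lra]).
        lra.
  - fold T' in F0, F1.
    (* Both sides are combined with weights [d_(k+1) - d_(k+2)] and [d_(k+2)]. The same weights turn
       the right-hand sides of [F0] and [F1] into twice the determinant identity. *)
    assert (Full : (d k - INR i * d (S k)) * T' <= 2).
    { assert (E : (d k - INR i * d (S k)) * T' =
        (d (S k) - d (S (S k))) * ((INR (A k) - INR i) * T') + d (S (S k)) * ((INR (A k) + 1 - INR i) * T'))
        by (rewrite Hd; ring).
      rewrite E.
      apply Rle_trans with ((d (S k) - d (S (S k))) * (2 * (INR (A k) * INR (q (S k)) + INR (q k))) +
        d (S (S k)) * (2 * ((INR (A k) + 1) * INR (q (S k)) + INR (q k)))).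
      - apply Rplus_le_compat; apply Rmult_le_compat_l; lra.
      - rewrite Hd in Hdet. lra. }
    assert (Hu' : 0 <= d k - t) by (unfold t; lra).
    destruct (Rle_lt_dec (d k - t) (t - INR i * d (S k))) as [h|h]; [left|right]; (split; [lra|]).
    + assert ((d k - t) * T <= (d k - INR i * d (S k)) / 2 * T') by (apply Rmult_le_compat; lra). lra.
    + assert ((t - INR i * d (S k)) * T <= (d k - INR i * d (S k)) / 2 * T') by (apply Rmult_le_compat; lra). lra.
Qed.

(** The end [n] alone suffices: [T <= q_(k+1) + q_(k+2)], and [d_(k+2) (q_(k+1) + q_(k+2)) <=
    d_(k+2) q_(k+1) + d_(k+1) q_(k+2) = 1]. *)
Lemma short_child_approx (k n : nat) (X y Q : R) :
  node theta q M k n X ->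
  0 <= s k * (y - X) <= d (S (S k)) ->
  INR n + INR (q k) <= Q < INR n + INR (q (S (S k))) ->
  approx theta Q y.
Proof.
  intros Hn Hu HQ.
  assert (HQ' : INR n + INR (q k) <= Q < INR n + INR (q k) + INR (A k) * INR (q (S k))).
  { rewrite (cv_q _ _ _ _ _ _ CV), plus_INR, mult_INR in HQ. lra. }
  destruct (locate _ _ _ _ HQ') as [i [Hi HQi]].
  apply (approx_in_node k n i X y Q _ Hn eq_refl); [exact HQi|]. left.
  replace (d k - (d k - s k * (y - X))) with (s k * (y - X)) by ring.
  split; [lra|].
  pose proof (cv_pos _ _ _ _ _ _ CV (S k)) as Hd1. pose proof (cv_pos _ _ _ _ _ _ CV (S (S k))) as Hd2.
  pose proof (cv_d _ _ _ _ _ _ CV k) as Hd. pose proof (cv_decr _ _ _ _ _ _ CV (S k)) as Hdd.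
  pose proof (cv_det _ _ _ _ _ _ CV k) as Hdet. rewrite Hd in Hdet.
  pose proof (q_pos k). pose proof (q_pos (S k)). pose proof (pos_INR i). pose proof (pos_INR n).
  assert (HiA : INR i + 1 <= INR (A k)) by (rewrite <- S_INR; apply le_INR; lia).
  assert (HM : 0 <= M k) by (destruct (sel_inv _ _ _ _ _ SEL k) as ((_ & h) & _); lra).
  destruct Hn as (_ & h2 & _).
  assert ((INR i + 1) * INR (q (S k)) <= INR (A k) * INR (q (S k))) by (apply Rmult_le_compat_r; lra).
  apply Rle_trans with (d (S (S k)) * (INR (q (S k)) + INR (q k) + INR (A k) * INR (q (S k)))).
  - apply Rmult_le_compat; try lra.
  - assert (0 <= (d (S k) - d (S (S k))) * (INR (q k) + INR (A k) * INR (q (S k)))).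
    { apply Rmult_le_pos; [lra|].
      assert (0 <= INR (A k) * INR (q (S k))) by (apply Rmult_le_pos; lra). lra. }
    lra.
Qed.

(** The recursion of [M] is made for this: with [j <= c_k - 1] the index is at most [q_k + c_k
    q_(k+1) - M_k = q_(k+2) - M_(k+1)]. *)
Lemma long_child_node (k n j : nat) (X : R) :
  node theta q M k n X -> (j < c k)%nat ->
  node theta q M (S k) (n + q k + j * q (S k)) (X + s k * d k + INR j * (s (S k) * d (S k))).
Proof.
  intros Hn Hj. split; [destruct Hn; lia|]. split; [|apply candidate; exact Hn].
  destruct Hn as (_ & h & _).
  rewrite !plus_INR, mult_INR, (cv_q _ _ _ _ _ _ CV), plus_INR, mult_INR, (sel_M _ _ _ _ _ SEL).
  assert (Hjc : INR j + 1 <= INR (c k)) by (rewrite <- S_INR; apply le_INR; lia).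
  assert ((INR j + 1) * INR (q (S k)) <= INR (c k) * INR (q (S k))).
  { apply Rmult_le_compat_r; [apply pos_INR|lra]. }
  lra.
Qed.

(** Since [c_(k+1) >= 1], the admissible range of indices does not shrink over two levels. *)
Lemma short_child_node (k n : nat) (X : R) :
  node theta q M k n X -> node theta q M (S (S k)) n X.
Proof.
  intros (h1 & h & h2). split; [exact h1|split; [|exact h2]].
  rewrite !(sel_M _ _ _ _ _ SEL), (cv_q _ _ _ _ _ _ CV (S k)), plus_INR, mult_INR.
  destruct (sel_range _ _ _ _ _ SEL (S k)) as [hc _]. apply le_INR in hc. cbn [INR] in hc.
  destruct (sel_range _ _ _ _ _ SEL k) as [hc' hA]. apply le_INR in hc', hA. cbn [INR] in hc'.
  pose proof (q_pos k). pose proof (q_pos (S k)).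
  assert (Hq : INR (q (S (S k))) = INR (A k) * INR (q (S k)) + INR (q k))
    by (rewrite (cv_q _ _ _ _ _ _ CV k), plus_INR, mult_INR; reflexivity).
  assert (1 * INR (q (S (S k))) <= INR (c (S k)) * INR (q (S (S k)))).
  { apply Rmult_le_compat_r; [apply pos_INR|lra]. }
  assert (0 <= INR (c k) * INR (q (S k))) by (apply Rmult_le_pos; lra).
  lra.
Qed.

End Nodes.

(** * Counting leaves and descending to a point outside a cover *)

(** Euler's continuant of [c k, ..., c (k + d - 1)]: the number of level-[k + d] descendants of a
    level-[k] node, short children skipping one level. *)
Fixpoint continuant (c : nat -> nat) (d k : nat) : R :=
  match d with
  | O => 1
  | S d' => match d' with
            | O => INR (c k)
            | S d'' => INR (c k) * continuant c d' (S k) + continuant c d'' (S (S k))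
            end
  end.

Lemma continuant_SS c d k :
  continuant c (S (S d)) k = INR (c k) * continuant c (S d) (S k) + continuant c d (S (S k)).
Proof. reflexivity. Qed.

Lemma increment_sum (H : nat -> R) (v : R) (n : nat) :
  (forall j, (j < n)%nat -> v <= H (S j) - H j) -> INR n * v <= H n - H O.
Proof.
  induction n as [|n IH]; intros Hv.
  - cbn. lra.
  - rewrite S_INR. assert (v <= H (S n) - H n) by (apply Hv; lia).
    assert (INR n * v <= H n - H O) by (apply IH; intros; apply Hv; lia). lra.
Qed.

Lemma common_bound (P : nat -> nat -> Prop) (n : nat) :
  (forall j, (j < n)%nat -> exists D, forall d, (D <= d)%nat -> P j d) ->
  exists D, forall j d, (j < n)%nat -> (D <= d)%nat -> P j d.
Proof.
  induction n as [|n IH]; intros H.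
  - exists O. lia.
  - destruct IH as [D HD]; [intros; apply H; lia|].
    destruct (H n) as [D' HD']; [lia|]. exists (D + D')%nat. intros j d Hj Hd.
    destruct (Nat.eq_dec j n) as [->|e]; [apply HD'; lia|apply HD; lia].
Qed.

Section Path.
Context (theta : R) (q A c : nat -> nat) (p : nat -> Z) (s d M g : nat -> R).
Context (CV : convergents theta q A p s d) (SEL : selection q A c M g).

Let g_pos k : 0 < g k.
Proof. destruct (sel_inv _ _ _ _ _ SEL k) as (_ & (h & _) & _). exact h. Qed.

Let c_pos k : 1 <= INR (c k).
Proof. destruct (sel_range _ _ _ _ _ SEL k) as [h _]. apply le_INR in h. exact h. Qed.

Lemma continuant_pos e : forall k, 0 < continuant c e k /\ 0 < continuant c (S e) k.
Proof.
  induction e as [|e IH]; intros k.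
  - cbn. pose proof (c_pos k). lra.
  - split; [apply IH|]. rewrite continuant_SS.
    destruct (IH (S k)) as [_ h]. destruct (IH (S (S k))) as [h' _]. pose proof (c_pos k). nra.
Qed.

Lemma continuant_mono e k : continuant c e (S k) <= continuant c (S e) k.
Proof.
  destruct e as [|e].
  - cbn. apply c_pos.
  - rewrite continuant_SS. pose proof (c_pos k).
    destruct (continuant_pos e (S k)) as [_ h]. destruct (continuant_pos e (S (S k))) as [h' _]. nra.
Qed.

(** Euler's splitting rule. The factor [g (S k)] counts the nodes of level [k], and [g k] those of
    level [k + 1] that are short children and so bypass level [k]. *)
Lemma continuant_split e : forall k,
  g (S e + S k)%nat = continuant c (S e) k * g (S k) + continuant c e (S k) * g k.
Proof.
  induction e as [|e IH]; intros k.
  - cbn. rewrite (sel_g _ _ _ _ _ SEL). ring.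
  - replace (S (S e) + S k)%nat with (S e + S (S k))%nat by lia.
    rewrite IH, (sel_g _ _ _ _ _ SEL), continuant_SS. ring.
Qed.

(* The share of the depth-[e] leaves lying below a level-[k] node exceeds [x], for arbitrarily
   large [e].  Taking "arbitrarily large" instead of a limit replaces the limit measure. *)
Definition charged (k : nat) (x : R) : Prop :=
  forall D, exists e, (D <= e)%nat /\ x * g (e + S k)%nat < continuant c e k.

(** All nodes of level [k] have equally many leaves and [g (S k)] counts these nodes, so no share
    exceeds [/ g (S k)]. *)
Lemma charged_bound k x : charged k x -> x < / g (S k).
Proof.
  intros H. destruct (H 1%nat) as [e [He Hx]].
  destruct e as [|e]; [lia|]. pose proof (continuant_split e k) as Hs.
  destruct (continuant_pos e (S k)) as [h _]. destruct (continuant_pos e k) as [_ h'].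
  pose proof (g_pos k) as G0. pose proof (g_pos (S k)) as G1.
  assert (0 < continuant c e (S k) * g k) by (apply Rmult_lt_0_compat; lra).
  assert (0 < continuant c (S e) k * g (S k)) by (apply Rmult_lt_0_compat; lra).
  apply Rmult_lt_reg_r with (continuant c (S e) k * g (S k)); [lra|].
  replace (/ g (S k) * (continuant c (S e) k * g (S k))) with (continuant c (S e) k) by (field; lra).
  destruct (Rle_lt_dec x 0) as [hx|hx]; [nra|].
  eapply Rle_lt_trans; [|exact Hx]. apply Rmult_le_compat_l; lra.
Qed.

(** By [continuant_mono] the share of the root is at least [/ (g 0 + g 1)], whatever the positive
    seeds of [g]. *)
Lemma charged_root x : x * (g 0%nat + g 1%nat) < 1 -> charged 0 x.
Proof.
  intros Hx D. exists (S D). split; [lia|]. rewrite continuant_split.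
  pose proof (continuant_mono D 0) as Hm. destruct (continuant_pos D 0) as [_ h'].
  destruct (continuant_pos D 1) as [h _].
  pose proof (g_pos 0) as G0. pose proof (g_pos 1) as G1.
  destruct (Rle_lt_dec x 0) as [hx|hx].
  - assert (0 < continuant c (S D) 0 * g 1%nat + continuant c D 1 * g 0%nat).
    { apply Rplus_lt_0_compat; apply Rmult_lt_0_compat; lra. }
    nra.
  - apply Rle_lt_trans with (continuant c (S D) 0 * (x * (g 0%nat + g 1%nat))).
    + assert (continuant c D 1 * g 0%nat <= continuant c (S D) 0 * g 0%nat) by (apply Rmult_le_compat_r; lra).
      assert (x * (continuant c D 1 * g 0%nat) <= x * (continuant c (S D) 0 * g 0%nat)) by (apply Rmult_le_compat_l; lra).
      lra.
    + rewrite <- (Rmult_1_r (continuant c (S D) 0)) at 2. apply Rmult_lt_compat_l; lra.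
Qed.

(** Pigeonhole: if all children failed from some depth on, a common depth for these finitely many
    failures would contradict the continuant recursion. The bounds for the long children are
    increments of [H], so that their sum telescopes. *)
Lemma charged_child k x (H : nat -> R) (xS : R) :
  charged k x -> H (c k) - H O + xS <= x ->
  (exists j, (j < c k)%nat /\ charged (S k) (H (S j) - H j)) \/ charged (S (S k)) xS.
Proof.
  intros Hx Hsum. apply NNPP. intros HN. apply not_or_and in HN. destruct HN as [HL HS].
  apply not_all_ex_not in HS. destruct HS as [DS HS].
  assert (HS' : forall e, (DS <= e)%nat -> continuant c e (S (S k)) <= xS * g (e + S (S (S k)))%nat).
  { intros e He. apply Rnot_lt_le. intros h. apply HS. exists e. auto. }
  destruct (common_bound (fun j e => continuant c e (S k) <= (H (S j) - H j) * g (e + S (S k))%nat) (c k))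
    as [DL HL'].
  { intros j Hj. assert (HN : ~ charged (S k) (H (S j) - H j)) by (intros h; apply HL; eauto).
    apply not_all_ex_not in HN. destruct HN as [D HD]. exists D.
    intros e He. apply Rnot_lt_le. intros h. apply HD. exists e. auto. }
  destruct (Hx (S (S (DS + DL)))) as [e [He Hxe]].
  (* Long children are examined at depth [S e] and the short one at depth [e], so all compare with
     the same leaf level. *)
  destruct e as [|[|e]]; try lia.
  set (G := g (S (S e) + S k)%nat) in *.
  assert (HG : 0 < G) by apply g_pos.
  specialize (HS' e ltac:(lia)).
  replace (e + S (S (S k)))%nat with (S (S e) + S k)%nat in HS' by lia. fold G in HS'.
  assert (Hv : INR (c k) * (continuant c (S e) (S k) / G) <= H (c k) - H O).
  { apply increment_sum. intros j Hj. specialize (HL' j (S e) Hj ltac:(lia)).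
    replace (S e + S (S k))%nat with (S (S e) + S k)%nat in HL' by lia. fold G in HL'.
    apply Rmult_le_reg_r with G; [lra|]. unfold Rdiv. rewrite Rmult_assoc, Rinv_l; lra. }
  rewrite continuant_SS in Hxe.
  assert (INR (c k) * continuant c (S e) (S k) <= (H (c k) - H O) * G).
  { replace (INR (c k) * continuant c (S e) (S k)) with
      (INR (c k) * (continuant c (S e) (S k) / G) * G) by (field; lra).
    apply Rmult_le_compat_r; lra. }
  assert ((H (c k) - H O + xS) * G <= x * G) by (apply Rmult_le_compat_r; lra).
  lra.
Qed.

Definition inside (k : nat) (X y : R) : Prop := 0 <= s k * (y - X) <= d k.

Lemma far_end_short k X :
  X + s k * d k + INR (A k) * (s (S k) * d (S k)) = X + s (S (S k)) * d (S (S k)).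
Proof.
  rewrite !(cv_alt _ _ _ _ _ _ CV), (cv_d _ _ _ _ _ _ CV k). ring.
Qed.

Lemma long_child_offset k j X y :
  s (S k) * (y - (X + s k * d k + INR j * (s (S k) * d (S k)))) =
  d k - s k * (y - X) - INR j * d (S k).
Proof.
  rewrite (cv_alt _ _ _ _ _ _ CV).
  destruct (cv_sign _ _ _ _ _ _ CV k) as [-> | ->]; ring.
Qed.

Lemma long_child_inside k j X y : (j < c k)%nat ->
  inside (S k) (X + s k * d k + INR j * (s (S k) * d (S k))) y -> inside k X y.
Proof.
  unfold inside. intros Hj H. rewrite long_child_offset in H.
  destruct (sel_range _ _ _ _ _ SEL k) as [_ hA].
  assert (HA : INR j + 1 <= INR (A k)) by (rewrite <- S_INR; apply le_INR; lia).
  pose proof (cv_pos _ _ _ _ _ _ CV (S k)). pose proof (cv_pos _ _ _ _ _ _ CV (S (S k))).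
  pose proof (cv_d _ _ _ _ _ _ CV k).
  assert ((INR j + 1) * d (S k) <= INR (A k) * d (S k)) by (apply Rmult_le_compat_r; lra).
  assert (0 <= INR j * d (S k)) by (apply Rmult_le_pos; [apply pos_INR|lra]).
  lra.
Qed.

Lemma short_child_inside k X y : inside (S (S k)) X y -> inside k X y.
Proof.
  unfold inside. rewrite !(cv_alt _ _ _ _ _ _ CV), Ropp_involutive.
  pose proof (cv_decr _ _ _ _ _ _ CV (S k)). pose proof (cv_decr _ _ _ _ _ _ CV k). lra.
Qed.

(** A node as its level, the index of its older end, and the lift of that end. *)
Definition state : Type := (nat * nat * R)%type.

Definition child (x x' : state) : Prop :=
  let '(k, n, X) := x in
  (exists j, (j < c k)%nat /\
     x' = (S k, (n + q k + j * q (S k))%nat, X + s k * d k + INR j * (s (S k) * d (S k)))) \/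
  x' = (S (S k), n, X).

Definition in_state (x : state) (y : R) : Prop := inside (fst (fst x)) (snd x) y.

Lemma child_inside x x' y : child x x' -> in_state x' y -> in_state x y.
Proof.
  destruct x as [[k n] X]. intros [(j & Hj & ->)| ->]; unfold in_state; cbn [fst snd].
  - apply long_child_inside; exact Hj.
  - apply short_child_inside.
Qed.

(* The index of the younger end of the node: from this time on both ends are available. *)
Definition birth (x : state) : nat := (snd (fst x) + q (fst (fst x)))%nat.

Let q_pos k : (1 <= q k)%nat.
Proof.
  destruct (sel_inv _ _ _ _ _ SEL k) as (([h _] & _) & _).
  apply (INR_lt 0) in h. lia.
Qed.

Lemma child_birth x x' : child x x' -> (birth x + 1 <= birth x')%nat.
Proof.
  destruct x as [[k n] X]. intros [(j & Hj & ->)| ->]; unfold birth; cbn [fst snd].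
  - pose proof (q_pos (S k)). lia.
  - rewrite (cv_q _ _ _ _ _ _ CV). pose proof (q_pos (S k)). pose proof (cv_A _ _ _ _ _ _ CV k). nia.
Qed.

(** A node answers for the times between its birth and that of the chosen child; along a path these
    periods leave no time uncovered. *)
Lemma child_approx x x' y Q : child x x' ->
  node theta q M (fst (fst x)) (snd (fst x)) (snd x) -> in_state x' y ->
  INR (birth x) <= Q < INR (birth x') -> approx theta Q y.
Proof.
  destruct x as [[k n] X]. unfold birth, in_state. cbn [fst snd].
  intros Hc Hn Hy HQ.
  assert (Hy' := child_inside _ _ _ Hc Hy). unfold in_state, inside in Hy'. cbn [fst snd] in Hy'.
  destruct Hc as [(j & Hj & ->)| ->]; cbn [fst snd] in *.
  - unfold inside in Hy. rewrite long_child_offset in Hy.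
    apply (long_child_approx theta q A c p s d M g CV SEL k n j X y Q Hn Hj); [lra|lra|].
    rewrite !plus_INR, mult_INR in HQ. lra.
  - unfold inside in Hy.
    apply (short_child_approx theta q A c p s d M g CV SEL k n X y Q Hn).
    + rewrite !(cv_alt _ _ _ _ _ _ CV), Ropp_involutive in Hy. exact Hy.
    + rewrite !plus_INR in HQ. exact HQ.
Qed.

Lemma path_point (f : nat -> state) :
  (forall t, child (f t) (f (S t))) -> exists y, forall t, in_state (f t) y.
Proof.
  intros Hf.
  (* The factor [(s - 1) / 2] is 0 or -1, so [lo] is the left end for either orientation. *)
  pose (lo := fun x : state => snd x + (s (fst (fst x)) - 1) / 2 * d (fst (fst x))).
  pose (hi := fun x : state => lo x + d (fst (fst x))).
  assert (Hin : forall x y, in_state x y <-> lo x <= y <= hi x).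
  { intros [[k n] X] y. unfold in_state, inside, hi, lo; cbn.
    destruct (cv_sign _ _ _ _ _ _ CV k) as [-> | ->]; split; lra. }
  assert (Hlh : forall x, lo x <= hi x).
  { intros x. unfold hi. pose proof (cv_pos _ _ _ _ _ _ CV (fst (fst x))). lra. }
  assert (Hnest : forall t r y, in_state (f (r + t)%nat) y -> in_state (f t) y).
  { intros t r y. induction r as [|r IH]; [auto|]. intros h. apply IH.
    eapply child_inside; [apply Hf|exact h]. }
  assert (Hlohi : forall t t', lo (f t) <= hi (f t')).
  { intros t t'. destruct (Nat.le_ge_cases t t') as [h|h].
    - assert (in_state (f t) (hi (f t'))).
      { apply (Hnest t (t' - t)%nat). replace (t' - t + t)%nat with t' by lia. apply Hin.
        split; [apply Hlh|lra]. }
      apply Hin in H. lra.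
    - assert (in_state (f t') (lo (f t))).
      { apply (Hnest t' (t - t')%nat). replace (t - t' + t')%nat with t by lia. apply Hin.
        split; [lra|apply Hlh]. }
      apply Hin in H. lra. }
  destruct (completeness (fun z => exists t, z = lo (f t))) as [y [Hy1 Hy2]].
  - exists (hi (f 0%nat)). intros z [t ->]. apply Hlohi.
  - eexists; exists 0%nat; reflexivity.
  - exists y. intros t. apply Hin. split; [apply Hy1; eauto|].
    apply Hy2. intros z [t' ->]. apply Hlohi.
Qed.

(** With [G] read as a distribution function, this is the mass of the node, made nonnegative by the
    sign. *)
Definition rise (G : R -> R) (k : nat) (X : R) : R := s k * (G (X + s k * d k) - G X).

(** The masses of all [A k] long pieces and of the short one add up to that of the node;
    monotonicity of [G] lets the pieces beyond [c k] be dropped. *)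
Lemma rise_split (G : R -> R) k X :
  (forall x y, x <= y -> G x <= G y) ->
  let H j := s (S k) * G (X + s k * d k + INR j * (s (S k) * d (S k))) in
  (forall j, rise G (S k) (X + s k * d k + INR j * (s (S k) * d (S k))) = H (S j) - H j) /\
  H (c k) - H O + rise G (S (S k)) X <= rise G k X.
Proof.
  intros HG H. split.
  - intros j. unfold rise, H. rewrite S_INR.
    replace (X + s k * d k + (INR j + 1) * (s (S k) * d (S k))) with
      (X + s k * d k + INR j * (s (S k) * d (S k)) + s (S k) * d (S k)) by ring. ring.
  - assert (Hm : H (c k) <= H (A k)).
    { unfold H. destruct (sel_range _ _ _ _ _ SEL k) as [_ hA]. apply le_INR in hA.
      pose proof (cv_pos _ _ _ _ _ _ CV (S k)) as hd.
      assert (INR (c k) * d (S k) <= INR (A k) * d (S k)) by (apply Rmult_le_compat_r; lra).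
      destruct (cv_sign _ _ _ _ _ _ CV (S k)) as [e|e]; rewrite e.
      - rewrite !Rmult_1_l. apply HG. lra.
      - assert (G (X + s k * d k + INR (A k) * (-1 * d (S k))) <= G (X + s k * d k + INR (c k) * (-1 * d (S k))))
          by (apply HG; lra). lra. }
    assert (E : H (A k) - H O + rise G (S (S k)) X = rise G k X).
    { unfold H, rise. rewrite far_end_short. cbn [INR]. rewrite Rmult_0_l, Rplus_0_r.
      rewrite !(cv_alt _ _ _ _ _ _ CV). ring. }
    lra.
Qed.

Lemma locate_birth (f : nat -> state) Q :
  (forall t, child (f t) (f (S t))) -> INR (birth (f 0%nat)) <= Q ->
  exists t, INR (birth (f t)) <= Q < INR (birth (f (S t))).
Proof.
  intros Hf HQ.
  assert (Hb : forall t, (t <= birth (f t))%nat).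
  { induction t as [|t IH]; [lia|]. pose proof (child_birth _ _ (Hf t)). lia. }
  destruct (INR_unbounded Q) as [T HT].
  assert (HT' : Q < INR (birth (f T))) by (pose proof (le_INR _ _ (Hb T)); lra).
  clear HT. induction T as [|T IH]; [lra|].
  destruct (Rle_lt_dec (INR (birth (f T))) Q) as [h|h]; [exists T; lra|apply IH, h].
Qed.

(** The path keeps the share of leaves above the mass of [G]. Every node on it thus has mass below
    [/ g (S k)], which later rules out that the cover reaches [y]. *)
Lemma avoiding_point (G : R -> R) (n0 : nat) (X0 : R) :
  (forall x y, x <= y -> G x <= G y) ->
  node theta q M 0 n0 X0 ->
  rise G 0 X0 * (g 0%nat + g 1%nat) < 1 ->
  exists y, inside 0 X0 y /\ (exists Q0, forall Q, Q >= Q0 -> approx theta Q y) /\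
    forall K, exists k X, (k = K \/ k = S K) /\ inside k X y /\ rise G k X < / g (S k).
Proof.
  intros HG Hn0 Hr0.
  destruct (dependent_choice_nat state
    (fun _ x => node theta q M (fst (fst x)) (snd (fst x)) (snd x) /\
                charged (fst (fst x)) (rise G (fst (fst x)) (snd x)))
    (fun _ x x' => child x x') (0%nat, n0, X0)) as [f [Hf0 Hf]].
  - cbn. split; [exact Hn0|]. apply charged_root. exact Hr0.
  - intros _ [[k n] X]; cbn [fst snd]. intros [Hn Hch].
    destruct (rise_split G k X HG) as [R1 R2].
    destruct (charged_child k _ (fun j => s (S k) * G (X + s k * d k + INR j * (s (S k) * d (S k)))) _ Hch R2) as [(j & Hj & Hc)|Hc].
    + cbv beta in Hc. rewrite <- R1 in Hc.
      eexists (_, _, _); cbn [fst snd]; split; [split; [|exact Hc]|].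
      * apply (long_child_node theta q A c p s d M g CV SEL k n j X Hn Hj).
      * left. exists j. split; [exact Hj|reflexivity].
    + eexists (_, _, _); cbn [fst snd]; split; [split; [|exact Hc]|].
      * apply (short_child_node theta q A c p s d M g CV SEL k n X Hn).
      * right. reflexivity.
  - assert (Hch : forall t, child (f t) (f (S t))) by (intros t; apply Hf).
    destruct (path_point f Hch) as [y Hy].
    exists y. split; [|split].
    + specialize (Hy 0%nat). rewrite Hf0 in Hy. exact Hy.
    + exists (INR (birth (f 0%nat))). intros Q HQ.
      destruct (locate_birth f Q Hch) as [t Ht]; [lra|].
      apply (child_approx (f t) (f (S t))); auto. apply Hf.
    (* A short child skips a level, but never two in a row, so the path meets level [K] or [S K]. *)
    + assert (HK : forall K, exists t, fst (fst (f t)) = K \/ fst (fst (f t)) = S K).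
      { induction K as [|K [t [IH|IH]]].
        - exists 0%nat. rewrite Hf0. auto.
        - exists (S t). pose proof (Hch t) as Hc. destruct (f t) as [[k n] X]. cbn in IH; subst k.
          destruct Hc as [(j & _ & ->)| ->]; cbn; auto.
        - exists t. auto. }
      intros K. destruct (HK K) as [t Ht].
      exists (fst (fst (f t))), (snd (f t)). split; [exact Ht|split; [apply Hy|]].
      apply charged_bound. apply Hf.
Qed.

End Path.

(** * Construction and growth of the convergents *)

(** Euclid's algorithm on the errors: [A k] is the integer quotient of [d k] by [d (S k)], and
    irrationality keeps the remainder nonzero. It starts from the fractions 1/0 and 0/1. *)
Lemma convergents_exist (theta : R) : 0 < theta < 1 -> irrational theta ->
  exists q A p s d, convergents theta q A p s d /\ q 0%nat = 0%nat /\ q 1%nat = 1%nat.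
Proof.
  intros Hth Hirr.
  (* The sign starts at -1 because the first error is [0 * theta - 1]. *)
  set (s := fun k : nat => - (-1) ^ k).
  assert (Halt : forall k, s (S k) = - s k) by (intros k; unfold s; cbn; ring).
  assert (Hs : forall k, s k = 1 \/ s k = -1).
  { induction k as [|k [IH|IH]]; [right; unfold s; cbn; ring| |]; rewrite Halt, IH; lra. }
  set (e := fun x : nat * Z => INR (fst x) * theta - IZR (snd x)).
  destruct (dependent_choice_nat ((nat * Z) * (nat * Z))
    (fun k x => 0 < s (S k) * e (snd x) < s k * e (fst x) /\
       INR (fst (snd x)) * (s k * e (fst x)) + INR (fst (fst x)) * (s (S k) * e (snd x)) = 1)
    (fun _ x x' => exists a, (1 <= a)%nat /\ x' = (snd x,
       ((a * fst (snd x) + fst (fst x))%nat, (Z.of_nat a * snd (snd x) + snd (fst x))%Z)))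
    ((0%nat, 1%Z), (1%nat, 0%Z))) as [f [Hf0 Hf]].
  - unfold s, e; cbn. lra.
  - intros k [[q0 p0] [q1 p1]]. unfold e; cbn [fst snd]. intros [Hd Hdet].
    set (d0 := s k * (INR q0 * theta - IZR p0)) in *.
    set (d1 := s (S k) * (INR q1 * theta - IZR p1)) in *.
    assert (Hj : exists j : nat, d0 < INR j * d1).
    { destruct (INR_unbounded (d0 / d1)) as [j Hj]. exists j.
      apply Rmult_lt_reg_r with (/ d1); [apply Rinv_0_lt_compat; lra|].
      rewrite Rmult_assoc, Rinv_r; lra. }
    destruct Hj as [j Hj].
    destruct (locate 0 d1 d0 j) as [a [_ Ha]]; [lra|]. rewrite !Rplus_0_l in Ha.
    assert (Ha1 : (1 <= a)%nat).
    { destruct a; [|lia]. cbn in Ha. lra. }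
    assert (Hne : s (S (S k)) * (INR (a * q1 + q0) * theta - IZR (Z.of_nat a * p1 + p0)) = d0 - INR a * d1).
    { unfold d0, d1. rewrite plus_INR, mult_INR, plus_IZR, mult_IZR, <- INR_IZR_INZ, !Halt. ring. }
    assert (Hneq : d0 - INR a * d1 <> 0).
    { intros H0. rewrite H0 in Hne.
      assert (Hz : INR (a * q1 + q0) * theta - IZR (Z.of_nat a * p1 + p0) = 0)
        by (destruct (Hs (S (S k))) as [h|h]; rewrite h in Hne; lra).
      assert (Hq : (a * q1 + q0 <> 0)%nat).
      { intros h. assert (q1 = 0%nat) by nia. assert (q0 = 0%nat) by nia. subst. cbn in Hdet. lra. }
      apply Hirr. exists (Z.of_nat a * p1 + p0)%Z, (Z.of_nat (a * q1 + q0)). split; [lia|].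
      rewrite <- INR_IZR_INZ. apply not_0_INR in Hq. field_simplify_eq; lra. }
    eexists (_, (_, _)). split; [|exists a; split; [exact Ha1|reflexivity]].
    cbn [fst snd]. fold d1. rewrite Hne. split; [lra|].
    rewrite plus_INR, mult_INR. lra.
  - assert (Hc : forall k, exists a, (1 <= a)%nat /\ f (S k) = (snd (f k),
       ((a * fst (snd (f k)) + fst (fst (f k)))%nat, (Z.of_nat a * snd (snd (f k)) + snd (fst (f k)))%Z)))
      by (intros k; apply Hf).
    apply functional_choice in Hc. destruct Hc as [A HA].
    assert (Hfs : forall k, fst (f (S k)) = snd (f k)) by (intros k; rewrite (proj2 (HA k)); reflexivity).
    assert (Hrec : forall k, snd (f (S k)) = ((A k * fst (snd (f k)) + fst (fst (f k)))%nat,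
      (Z.of_nat (A k) * snd (snd (f k)) + snd (fst (f k)))%Z)).
    { intros k; rewrite (proj2 (HA k)); reflexivity. }
    exists (fun k => fst (fst (f k))), A, (fun k => snd (fst (f k))), s, (fun k => s k * e (fst (f k))).
    split; [|rewrite (Hfs 0%nat), Hf0; auto].
    assert (Hss : forall k, s k * s k = 1) by (intros k; destruct (Hs k) as [-> | ->]; ring).
    split; try exact Hs; try exact Halt; intros k; rewrite ?Hfs, ?Hrec.
    + unfold e. rewrite <- Rmult_assoc, Hss. ring.
    + destruct (Hf k) as [[[h1 h2] _] _]. lra.
    + destruct (Hf k) as [[[h1 h2] _] _]. lra.
    + unfold e. cbn [fst snd]. rewrite plus_INR, mult_INR, plus_IZR, mult_IZR, <- INR_IZR_INZ, !Halt. ring.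
    + reflexivity.
    + exact (proj2 (proj1 (Hf k))).
    + apply HA.
Qed.

Lemma convergents_growth (theta : R) q A p s d : convergents theta q A p s d ->
  (1 <= q 1)%nat -> forall k, (k <= q (S k))%nat /\ (q (S k) <= q (S (S k)))%nat /\ (1 <= q (S k))%nat.
Proof.
  intros CV Hq1.
  assert (Hpos : forall k, (1 <= q (S k))%nat).
  { induction k as [|k IH]; [exact Hq1|].
    rewrite (cv_q _ _ _ _ _ _ CV). pose proof (cv_A _ _ _ _ _ _ CV k). nia. }
  assert (Hmono : forall k, (q (S k) + q k <= q (S (S k)))%nat).
  { intros k. rewrite (cv_q _ _ _ _ _ _ CV). pose proof (cv_A _ _ _ _ _ _ CV k). nia. }
  intros k. split; [|split; [pose proof (Hmono k); lia|apply Hpos]].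
  induction k as [|k IH]; [lia|]. pose proof (Hmono k). pose proof (Hpos k).
  destruct k; [lia|]. pose proof (Hpos k). lia.
Qed.

(** * Lower bounds for the distance from exponent one *)

Lemma Rpower_pos (x a : R) : 0 < Rpower x a.
Proof. apply exp_pos. Qed.

Lemma Rpower_neg_small (alpha eps : R) : 0 < alpha -> 0 < eps ->
  exists x0, 1 <= x0 /\ forall x, x0 <= x -> Rpower x (- alpha) < eps.
Proof.
  intros Ha He. exists (Rmax 1 (Rpower (2 / eps) (/ alpha))). split; [apply Rmax_l|].
  intros x Hx. pose proof (Rmax_l 1 (Rpower (2 / eps) (/ alpha))).
  pose proof (Rmax_r 1 (Rpower (2 / eps) (/ alpha))).
  assert (H2 : 0 < 2 / eps) by (apply Rdiv_lt_0_compat; lra).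
  assert (Hp : 2 / eps <= Rpower x alpha).
  { apply Rle_trans with (Rpower (Rpower (2 / eps) (/ alpha)) alpha).
    - rewrite Rpower_mult, Rinv_l, Rpower_1 by lra. lra.
    - apply Rle_Rpower_l; [lra|]. split; [apply Rpower_pos|lra]. }
  rewrite Rpower_Ropp.
  apply Rle_lt_trans with (/ (2 / eps)); [apply Rinv_le_contravar; assumption|].
  replace (/ (2 / eps)) with (eps / 2) by (field; lra). lra.
Qed.

Lemma dnint_irrational_pos (theta : R) (j : nat) :
  irrational theta -> (1 <= j)%nat -> 0 < dnint (INR j * theta).
Proof.
  intros Hirr Hj. destruct (dnint_pos (INR j * theta)) as [h|h]; [exact h|exfalso].
  destruct (dnint_attained (INR j * theta)) as [p Hp]. rewrite <- h in Hp.
  symmetry in Hp. assert (H0 : INR j * theta - IZR p = 0).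
  { destruct (Req_dec (INR j * theta - IZR p) 0) as [e|e]; [exact e|].
    apply Rabs_no_R0 in e. contradiction. }
  apply Hirr. exists p, (Z.of_nat j). split; [lia|]. rewrite <- INR_IZR_INZ.
  assert (INR j <> 0) by (apply not_0_INR; lia).
  apply Rmult_eq_reg_r with (INR j); [|assumption]. field_simplify; lra.
Qed.

(** For large [j] the constant 1 works by the definition of the exponent; the finitely many other
    [j] only lower the constant, since irrationality makes their distances positive. *)
Lemma irr_exponent_lower (theta delta : R) :
  irrational theta -> irr_exponent_is theta 1 -> 0 < delta ->
  exists c, 0 < c /\ forall j, (1 <= j)%nat -> c * Rpower (INR j) (- (1 + delta)) <= dnint (INR j * theta).
Proof.
  intros Hirr [Hub _] Hd.
  assert (HJ : exists J : nat, forall j, (J <= j)%nat -> (1 <= j)%nat ->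
    Rpower (INR j) (- (1 + delta)) <= dnint (INR j * theta)).
  { apply NNPP. intros HN.
    (* The intermediate exponent [1 + delta / 2] leaves a factor [j^(-delta/2)] that tends to 0, and
       it still exceeds the supremum 1. *)
    assert (Hl : liminf_zero theta (1 + delta / 2)).
    { intros eps He N.
      destruct (Rpower_neg_small (delta / 2) eps) as [x0 [_ Hx0]]; [lra|lra|].
      destruct (INR_unbounded x0) as [J HJ].
      apply NNPP. intros HN'. apply HN. exists (N + J)%nat. intros j Hj Hj1.
      apply Rnot_lt_le. intros h. apply HN'. exists j. split; [lia|split; [exact Hj1|]].
      assert (Hxj : x0 <= INR j).
      { apply Rle_trans with (INR J); [lra|]. apply le_INR. lia. }
      apply Rle_lt_trans with (Rpower (INR j) (1 + delta / 2) * Rpower (INR j) (- (1 + delta))).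
      - apply Rmult_le_compat_l; [left; apply Rpower_pos|lra].
      - rewrite <- Rpower_plus. replace (1 + delta / 2 + - (1 + delta)) with (- (delta / 2)) by field.
        apply Hx0, Hxj. }
    assert (Hle : 1 + delta / 2 <= 1) by (apply Hub; split; [lra|exact Hl]). lra. }
  destruct HJ as [J HJ]. clear Hub.
  assert (Hfin : forall K : nat, exists c, 0 < c <= 1 /\ forall j, (j < K)%nat -> (1 <= j)%nat ->
    c * Rpower (INR j) (- (1 + delta)) <= dnint (INR j * theta)).
  { induction K as [|K [c [Hc IH]]]; [exists 1; split; [lra|lia]|].
    destruct (Nat.eq_dec K 0) as [->|HK]; [exists 1; split; [lra|lia]|].
    pose proof (dnint_irrational_pos theta K Hirr ltac:(lia)) as Hp.
    pose proof (Rpower_pos (INR K) (- (1 + delta))) as Hr.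
    set (r := Rpower (INR K) (- (1 + delta))) in *. set (v := dnint (INR K * theta)) in *.
    assert (0 < v / r) by (apply Rdiv_lt_0_compat; lra).
    exists (Rmin c (v / r)). pose proof (Rmin_l c (v / r)). pose proof (Rmin_r c (v / r)).
    split; [split; [apply Rmin_glb_lt; lra|lra]|].
    intros j Hj Hj1. destruct (Nat.eq_dec j K) as [->|e].
    - fold r v. apply Rle_trans with (v / r * r); [apply Rmult_le_compat_r; lra|].
      right. field. lra.
    - eapply Rle_trans; [|apply IH; lia]. apply Rmult_le_compat_r; [left; apply Rpower_pos|lra]. }
  destruct (Hfin J) as [c [Hc Hcj]]. exists c. split; [lra|]. intros j Hj.
  destruct (Nat.lt_ge_cases j J) as [h|h]; [apply Hcj; lia|].
  eapply Rle_trans; [|apply HJ; lia].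
  rewrite <- (Rmult_1_l (Rpower (INR j) _)) at 2.
  apply Rmult_le_compat_r; [left; apply Rpower_pos|lra].
Qed.

(** * The case of [tau] below 1 *)

(** The determinant [e] is a unit, so [n p_k = r] is solvable modulo [q_k], where [r / q_k] is
    within [1 / q_k] of [y]. Replacing [n p_k / q_k] by [n theta] costs at most another
    [1 / q_k]. *)
Lemma convergents_dense (theta : R) q A p s d (k : nat) (y : R) :
  convergents theta q A p s d -> (1 <= q k <= q (S k))%nat ->
  exists n, (1 <= n <= q k)%nat /\ dnint (INR n * theta - y) <= 2 / INR (q k).
Proof.
  intros CV Hq.
  set (e := (Z.of_nat (q (S k)) * p k - Z.of_nat (q k) * p (S k))%Z).
  assert (He : (e = 1 \/ e = -1)%Z).
  { assert (H : IZR e = - s k).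
    { unfold e. rewrite minus_IZR, !mult_IZR, <- !INR_IZR_INZ.
      pose proof (cv_err _ _ _ _ _ _ CV k) as E0. pose proof (cv_err _ _ _ _ _ _ CV (S k)) as E1.
      rewrite (cv_alt _ _ _ _ _ _ CV) in E1.
      replace (IZR (p k)) with (INR (q k) * theta - s k * d k) by lra.
      replace (IZR (p (S k))) with (INR (q (S k)) * theta - - s k * d (S k)) by lra.
      transitivity (- s k * (INR (q (S k)) * d k + INR (q k) * d (S k))); [ring|].
      rewrite (cv_det _ _ _ _ _ _ CV). ring. }
    destruct (cv_sign _ _ _ _ _ _ CV k) as [h|h]; rewrite h in H; [right|left]; apply eq_IZR; lra. }
  set (Qz := Z.of_nat (q k)) in *. set (r := (up (y * INR (q k)) - 1)%Z).
  assert (Hr : 0 <= y * INR (q k) - IZR r <= 1).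
  { unfold r. rewrite minus_IZR. pose proof (archimed (y * INR (q k))). lra. }
  (* Subtracting 1 before the reduction and adding it back gives a representative in [1..q k]
     instead of [0..q k - 1]. *)
  set (w := ((e * r * Z.of_nat (q (S k)) - 1) mod Qz)%Z).
  assert (HQz : (0 < Qz)%Z) by lia.
  pose proof (Z.mod_pos_bound (e * r * Z.of_nat (q (S k)) - 1) Qz HQz) as Hw. fold w in Hw.
  pose proof (Z.div_mod (e * r * Z.of_nat (q (S k)) - 1) Qz ltac:(lia)) as Hdm. fold w in Hdm.
  set (v := ((e * r * Z.of_nat (q (S k)) - 1) / Qz)%Z) in *.
  set (n := Z.to_nat (w + 1)).
  assert (Hn : Z.of_nat n = (w + 1)%Z) by (unfold n; lia).
  assert (Hnq : (1 <= n <= q k)%nat) by lia.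
  set (m := (e * r * p (S k) - v * p k)%Z).
  assert (Hm : (Z.of_nat n * p k = r + m * Qz)%Z).
  { rewrite Hn. replace (w + 1)%Z with (e * r * Z.of_nat (q (S k)) - Qz * v)%Z by lia.
    unfold m. assert (Hee : (e * e = 1)%Z) by (destruct He as [-> | ->]; reflexivity).
    transitivity (e * r * (Z.of_nat (q (S k)) * p k - Qz * p (S k)) + (e * r * p (S k) - v * p k) * Qz)%Z; [ring|].
    fold e. replace (e * r * e)%Z with (e * e * r)%Z by ring. rewrite Hee. ring. }
  exists n. split; [exact Hnq|].
  eapply Rle_trans; [apply (dnint_le _ m)|].
  assert (Hq0 : 1 <= INR (q k)) by (apply (le_INR 1); lia).
  apply (f_equal IZR) in Hm. rewrite plus_IZR, !mult_IZR in Hm. unfold Qz in Hm.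
  rewrite <- !INR_IZR_INZ in Hm.
  assert (E : INR n * theta - y - IZR m =
    (INR n * (s k * d k) + (IZR r - y * INR (q k))) / INR (q k)).
  { rewrite <- (cv_err _ _ _ _ _ _ CV k). field_simplify_eq; [|lra]. lra. }
  rewrite E. unfold Rdiv. rewrite Rabs_mult, (Rabs_right (/ INR (q k))).
  2: { apply Rle_ge. left. apply Rinv_0_lt_compat. lra. }
  apply Rmult_le_compat_r; [left; apply Rinv_0_lt_compat; lra|].
  eapply Rle_trans; [apply Rabs_triang|].
  assert (H1 : Rabs (INR n * (s k * d k)) <= 1).
  { rewrite (sign_abs (s k)) by apply (cv_sign _ _ _ _ _ _ CV).
    replace (s k * (INR n * (s k * d k))) with (INR n * d k).
    2: { destruct (cv_sign _ _ _ _ _ _ CV k) as [-> | ->]; ring. }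
    pose proof (cv_pos _ _ _ _ _ _ CV k). pose proof (cv_pos _ _ _ _ _ _ CV (S k)).
    rewrite Rabs_right by (apply Rle_ge, Rmult_le_pos; [apply pos_INR|lra]).
    assert (INR n <= INR (q (S k))) by (apply le_INR; lia).
    assert (INR n * d k <= INR (q (S k)) * d k) by (apply Rmult_le_compat_r; lra).
    assert (0 <= INR (q k) * d (S k)) by (apply Rmult_le_pos; lra).
    pose proof (cv_det _ _ _ _ _ _ CV k). lra. }
  assert (H2 : Rabs (IZR r - y * INR (q k)) <= 1) by (rewrite Rabs_left1; lra).
  lra.
Qed.

Lemma dnint_sub_le (u v y : R) : dnint (u - v) <= dnint (u - y) + dnint (v - y).
Proof.
  destruct (dnint_attained (u - y)) as [a Ha]. destruct (dnint_attained (v - y)) as [b Hb].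
  rewrite Ha, Hb, <- (Rabs_Ropp (v - y - IZR b)).
  eapply Rle_trans; [apply (dnint_le _ (a - b))|].
  rewrite minus_IZR. eapply Rle_trans; [|apply Rabs_triang]. right. f_equal. ring.
Qed.

(** If [x = q_(k+1) <= Q < q_(k+2)], then [c Q < x^(1+delta)]. As [(1 + delta) tau < 1], the density
    bound [2 / x] falls below [Q^(-tau)]. *)
Lemma U_full (theta tau y : R) :
  0 < theta < 1 -> irrational theta -> irr_exponent_is theta 1 -> 0 < tau < 1 -> U tau theta y.
Proof.
  intros Hth Hirr Hexp Htau.
  destruct (convergents_exist theta Hth Hirr) as (q & A & p & s & d & CV & Hq0 & Hq1).
  pose proof (convergents_growth _ _ _ _ _ _ CV ltac:(lia)) as Hgr.
  set (delta := (1 - tau) / 2).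
  assert (Hdelta : 0 < delta) by (unfold delta; lra).
  destruct (irr_exponent_lower theta delta Hirr Hexp Hdelta) as [c [Hc Hlow]].
  set (alpha := 1 - (1 + delta) * tau).
  assert (Halpha : 0 < alpha) by (unfold alpha, delta; nra).
  destruct (Rpower_neg_small alpha (Rpower c tau / 2)) as [x0 [Hx1 Hx0]]; [exact Halpha| |].
  { pose proof (Rpower_pos c tau). lra. }
  (* The second term forces [x >= x0] through [c Q < x^(1+delta)]. *)
  exists (Rmax 1 (Rpower x0 (1 + delta) / c)). intros Q HQ.
  pose proof (Rmax_l 1 (Rpower x0 (1 + delta) / c)) as HQ1.
  pose proof (Rmax_r 1 (Rpower x0 (1 + delta) / c)) as HQ2.
  assert (Hk : exists k, INR (q (S k)) <= Q < INR (q (S (S k)))).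
  { destruct (INR_unbounded Q) as [T HT].
    assert (HT' : Q < INR (q (S T))) by (pose proof (le_INR _ _ (proj1 (Hgr T))); lra).
    clear HT. induction T as [|T IH]; [rewrite Hq1 in HT'; cbn in HT'; lra|].
    destruct (Rle_lt_dec (INR (q (S T))) Q) as [h|h]; [exists T; lra|apply IH, h]. }
  destruct Hk as [k Hk]. destruct (Hgr k) as (_ & Hmono & Hqp).
  set (x := INR (q (S k))) in *.
  assert (Hx : 1 <= x) by (apply (le_INR 1); exact Hqp).
  assert (HcQ : c * Q < Rpower x (1 + delta)).
  { pose proof (Hlow (q (S k)) Hqp) as Hl. fold x in Hl.
    assert (Hd : dnint (x * theta) <= d (S k)).
    { eapply Rle_trans; [apply (dnint_le _ (p (S k)))|]. unfold x.
      rewrite (cv_err _ _ _ _ _ _ CV), (sign_abs (s (S k))) by apply (cv_sign _ _ _ _ _ _ CV).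
      pose proof (cv_pos _ _ _ _ _ _ CV (S k)).
      replace (s (S k) * (s (S k) * d (S k))) with (d (S k)).
      - rewrite Rabs_right; lra.
      - destruct (cv_sign _ _ _ _ _ _ CV (S k)) as [-> | ->]; ring. }
    pose proof (cv_det _ _ _ _ _ _ CV (S k)) as Hdet. fold x in Hdet.
    pose proof (cv_pos _ _ _ _ _ _ CV (S k)) as Hd1. pose proof (cv_pos _ _ _ _ _ _ CV (S (S k))) as Hd2.
    assert (0 < x * d (S (S k))) by (apply Rmult_lt_0_compat; lra).
    assert (Q * d (S k) < INR (q (S (S k))) * d (S k)) by (apply Rmult_lt_compat_r; lra).
    rewrite Rpower_Ropp in Hl. pose proof (Rpower_pos x (1 + delta)) as Hp.
    set (P := Rpower x (1 + delta)) in *.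
    assert (Q * (c * / P) <= Q * d (S k)) by (apply Rmult_le_compat_l; lra).
    apply Rmult_lt_reg_r with (/ P); [apply Rinv_0_lt_compat; lra|].
    rewrite Rinv_r by lra. lra. }
  assert (Hxx : x0 <= x).
  { apply Rnot_lt_le. intros h.
    assert (Rpower x (1 + delta) <= Rpower x0 (1 + delta)) by (apply Rle_Rpower_l; lra).
    assert (Hh : Rpower x0 (1 + delta) / c * c <= Q * c) by (apply Rmult_le_compat_r; lra).
    replace (Rpower x0 (1 + delta) / c * c) with (Rpower x0 (1 + delta)) in Hh by (field; lra). lra. }
  destruct (convergents_dense theta q A p s d (S k) y CV ltac:(lia)) as [n [Hn Hdn]].
  exists n. split; [lia|split].
  { apply Rle_trans with x; [apply le_INR; lia|lra]. }
  eapply Rle_lt_trans; [exact Hdn|]. fold x.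
  specialize (Hx0 x Hxx). rewrite !Rpower_Ropp in *.
  assert (HR : Rpower (c * Q) tau <= Rpower (Rpower x (1 + delta)) tau).
  { apply Rle_Rpower_l; [lra|]. split; [apply Rmult_lt_0_compat; lra|lra]. }
  rewrite <- Rpower_mult_distr in HR by lra.
  rewrite Rpower_mult in HR.
  assert (HX : Rpower x ((1 + delta) * tau) * Rpower x alpha = x).
  { rewrite <- Rpower_plus. unfold alpha. replace ((1 + delta) * tau + (1 - (1 + delta) * tau)) with 1 by ring.
    apply Rpower_1. lra. }
  pose proof (Rpower_pos x alpha) as P1. pose proof (Rpower_pos Q tau) as P2. pose proof (Rpower_pos c tau) as P3.
  pose proof (Rpower_pos x ((1 + delta) * tau)) as P4.
  set (X := Rpower x ((1 + delta) * tau)) in *. set (Xa := Rpower x alpha) in *.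
  set (Qt := Rpower Q tau) in *. set (ct := Rpower c tau) in *.
  assert (H2 : 2 < ct * Xa).
  { apply Rmult_lt_compat_r with (r := Xa) in Hx0; [|lra]. rewrite Rinv_l in Hx0; lra. }
  apply Rmult_lt_reg_r with Qt; [lra|]. rewrite Rinv_l by lra.
  apply Rmult_lt_reg_r with x; [lra|].
  replace (2 / x * Qt * x) with (2 * Qt) by (field; lra).
  rewrite Rmult_1_l, <- HX.
  apply Rlt_le_trans with (ct * Xa * Qt); [apply Rmult_lt_compat_r; lra|].
  replace (ct * Xa * Qt) with (ct * Qt * Xa) by ring. apply Rmult_le_compat_r; lra.
Qed.

(** * The case of [tau] above 1 *)

Lemma frac_unique (t y : R) (p : Z) : 0 <= y < 1 -> t - y = IZR p -> y = frac t.
Proof.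
  intros Hy Hp. unfold frac.
  assert (h : (p + 1)%Z = up t) by (apply tech_up; rewrite plus_IZR; lra).
  rewrite <- h, plus_IZR. lra.
Qed.

Lemma U_orbit (theta tau y : R) :
  irrational theta -> irr_exponent_is theta 1 -> 1 < tau -> in_T y ->
  (U tau theta y <-> exists i : nat, (1 <= i)%nat /\ y = frac (INR i * theta)).
Proof.
  intros Hirr Hexp Htau Hy. split.
  - intros [Q0 HU].
    set (delta := (tau - 1) / 2). assert (Hdelta : 0 < delta) by (unfold delta; lra).
    destruct (irr_exponent_lower theta delta Hirr Hexp Hdelta) as [c [Hc Hlow]].
    destruct (Rpower_neg_small delta (c / 2)) as [x0 [Hx1 Hx0]]; [lra|lra|].
    destruct (INR_unbounded (Rmax x0 Q0)) as [N0 HN0].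
    pose proof (Rmax_l x0 Q0). pose proof (Rmax_r x0 Q0).
    set (good := fun n N => (1 <= n <= N)%nat /\ dnint (INR n * theta - y) < Rpower (INR N) (- tau)).
    assert (Hex : forall N, (N0 <= N)%nat -> exists n, good n N).
    { intros N HN. apply le_INR in HN. destruct (HU (INR N)) as [n (h1 & h2 & h3)]; [lra|].
      exists n. split; [split; [exact h1|apply INR_le, h2]|exact h3]. }
    (* Two such indices would give [||(b - a) theta|| < 2 N^(-tau) < c N^(-(1+delta))], as
       [tau = 1 + 2 delta]. The bound [S N] allows comparison of the approximants at [N] and
       [N + 1], and still [b - a <= N]. *)
    assert (Hsep : forall N a b, (N0 <= N)%nat -> (1 <= a)%nat -> (a < b <= S N)%nat ->
      dnint (INR a * theta - y) < Rpower (INR N) (- tau) ->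
      dnint (INR b * theta - y) < Rpower (INR N) (- tau) -> False).
    { intros N a b HN Ha Hab Da Db.
      pose proof (Hlow (b - a)%nat ltac:(lia)) as Hl.
      rewrite minus_INR, Rmult_minus_distr_r in Hl by lia.
      pose proof (dnint_sub_le (INR b * theta) (INR a * theta) y) as Ht.
      apply le_INR in HN. assert (HNx : x0 <= INR N) by lra. specialize (Hx0 _ HNx).
      assert (Hba : 1 <= INR b - INR a <= INR N).
      { rewrite <- minus_INR by lia. split; [apply (le_INR 1); lia|apply le_INR; lia]. }
      assert (HR : Rpower (INR N) (- (1 + delta)) <= Rpower (INR b - INR a) (- (1 + delta))).
      { rewrite !Rpower_Ropp. apply Rinv_le_contravar; [apply Rpower_pos|]. apply Rle_Rpower_l; lra. }
      replace (- tau) with (- (1 + delta) + - delta) in Da, Db by (unfold delta; field).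
      rewrite Rpower_plus in Da, Db. pose proof (Rpower_pos (INR N) (- (1 + delta))) as HP.
      set (P := Rpower (INR N) (- (1 + delta))) in *.
      assert (c * P <= c * Rpower (INR b - INR a) (- (1 + delta))) by (apply Rmult_le_compat_l; lra).
      assert (P * Rpower (INR N) (- delta) < P * (c / 2)) by (apply Rmult_lt_compat_l; lra).
      lra. }
    destruct (Hex N0 (Nat.le_refl _)) as [i Hi].
    assert (Hall : forall r, good i (r + N0)%nat).
    { induction r as [|r IH]; [exact Hi|].
      destruct (Hex (S r + N0)%nat ltac:(lia)) as [n Hn].
      assert (HNpos : 1 <= INR (r + N0)) by (apply (le_INR 1); destruct IH; lia).
      assert (Hm : Rpower (INR (S r + N0)) (- tau) <= Rpower (INR (r + N0)) (- tau)).
      { rewrite !Rpower_Ropp. apply Rinv_le_contravar; [apply Rpower_pos|].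
        apply Rle_Rpower_l; [lra|]. split; [lra|apply le_INR; lia]. }
      destruct IH as [h1 h2]. destruct Hn as [h3 h4].
      destruct (Nat.lt_trichotomy i n) as [h|[h|h]].
      - exfalso. apply (Hsep (r + N0)%nat i n); try lia; lra.
      - subst n. split; [lia|exact h4].
      - exfalso. apply (Hsep (r + N0)%nat n i); try lia; lra. }
    exists i. split; [destruct Hi; lia|].
    destruct (dnint_attained (INR i * theta - y)) as [p Hp].
    (* The single index [i] serves at every [N], so its distance lies below every [N^(-tau)]. *)
    assert (Hz : dnint (INR i * theta - y) = 0).
    { destruct (dnint_pos (INR i * theta - y)) as [h|h]; [exfalso|symmetry; exact h].
      destruct (Rpower_neg_small tau (dnint (INR i * theta - y))) as [x1 [_ Hx]]; [lra|exact h|].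
      destruct (INR_unbounded x1) as [r Hr]. destruct (Hall r) as [_ h'].
      assert (x1 <= INR (r + N0)).
      { apply Rle_trans with (INR r); [lra|apply le_INR; lia]. }
      specialize (Hx _ H1). lra. }
    apply (frac_unique _ _ p Hy). rewrite Hz in Hp.
    destruct (Req_dec (INR i * theta - y - IZR p) 0) as [e|e]; [lra|].
    apply Rabs_no_R0 in e. congruence.
  - intros [i [Hi ->]]. exists (INR i). intros Q HQ. exists i. split; [exact Hi|split; [lra|]].
    apply Rle_lt_trans with 0; [|apply Rpower_pos].
    eapply Rle_trans; [apply (dnint_le _ (up (INR i * theta) - 1))|].
    right. unfold frac. rewrite minus_IZR.
    replace (_ - _ - _) with 0 by ring. apply Rabs_R0.
Qed.

(** * The lower bound for the dimension at [tau = 1] *)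

Lemma convergents_shift (theta : R) q A p s d (K : nat) : convergents theta q A p s d ->
  convergents theta (fun k => q (k + K)%nat) (fun k => A (k + K)%nat) (fun k => p (k + K)%nat)
    (fun k => s (k + K)%nat) (fun k => d (k + K)%nat).
Proof. intros []. split; intros k; cbn; auto. Qed.

Lemma sum_f_R0_le (u v : nat -> R) (N : nat) : (forall k, u k <= v k) -> sum_f_R0 u N <= sum_f_R0 v N.
Proof. intros H. apply sum_Rle. intros; apply H. Qed.

(** [G] is the distribution function of the sum of the measures with density [w i] on [[a i, b i]];
    [F i] is the ramp contributed by one of them. *)
Lemma charge_function (a b w : nat -> R) (eps : R) :
  (forall i, a i <= b i) -> (forall i, 0 <= w i) ->
  (forall N, sum_f_R0 (fun i => w i * (b i - a i)) N <= eps) ->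
  exists G : R -> R,
    (forall x y, x <= y -> G x <= G y <= G x + eps) /\
    forall i x y, a i <= x -> x <= y -> y <= b i -> w i * (y - x) <= G y - G x.
Proof.
  intros Hab Hw Hsum.
  set (F := fun i t => w i * Rmax 0 (Rmin t (b i) - a i)).
  assert (F0 : forall i t, 0 <= F i t) by (intros; apply Rmult_le_pos; [apply Hw|apply Rmax_l]).
  assert (Fb : forall i t, F i t <= w i * (b i - a i)).
  { intros i t. apply Rmult_le_compat_l; [apply Hw|]. specialize (Hab i).
    pose proof (Rmin_r t (b i)). apply Rmax_lub; lra. }
  assert (Fm : forall i x y, x <= y -> F i x <= F i y).
  { intros i x y h. apply Rmult_le_compat_l; [apply Hw|].
    unfold Rmax, Rmin. repeat destruct Rle_dec; lra. }
  set (S_ := fun t N => sum_f_R0 (fun i => F i t) N).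
  assert (Hb : forall t N, 0 <= S_ t N <= eps).
  { intros t N. split; [apply cond_pos_sum; intros; apply F0|].
    eapply Rle_trans; [|apply (Hsum N)]. apply sum_f_R0_le. intros; apply Fb. }
  assert (HG : forall t, exists l, Un_cv (S_ t) l).
  { intros t. destruct (growing_cv (S_ t)) as [l Hl].
    - intros N. unfold S_. cbn. specialize (F0 (S N) t). lra.
    - exists eps. intros x [N ->]. apply Hb.
    - exists l. exact Hl. }
  apply functional_choice in HG. destruct HG as [G HG].
  assert (Hdiff : forall x y, x <= y -> Un_growing (fun N => S_ y N - S_ x N) /\
    Un_cv (fun N => S_ y N - S_ x N) (G y - G x)).
  { intros x y h. split; [|apply CV_minus; apply HG].
    intros N. unfold S_. cbn. specialize (Fm (S N) x y h). lra. }
  assert (Hge : forall x y i, x <= y -> F i y - F i x <= G y - G x).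
  { intros x y i h. destruct (Hdiff x y h) as [h1 h2].
    eapply Rle_trans; [|apply (growing_ineq _ _ h1 h2 i)]. unfold S_.
    destruct i as [|i]; cbn [sum_f_R0]; [lra|].
    assert (sum_f_R0 (fun i0 => F i0 x) i <= sum_f_R0 (fun i0 => F i0 y) i)
      by (apply sum_f_R0_le; intros; apply Fm, h).
    lra. }
  assert (HGr : forall t, 0 <= G t <= eps).
  { intros t. split.
    - eapply Rle_trans; [apply (proj1 (Hb t 0%nat))|].
      apply (growing_ineq (S_ t)); [|apply HG]. intros N. unfold S_. cbn. specialize (F0 (S N) t). lra.
    - apply (@Rle_cv_lim (S_ t) (fun _ => eps)); [intros; apply Hb|apply HG|].
      intros e He. exists 0%nat. intros. unfold Rdist. rewrite Rminus_diag, Rabs_R0. exact He. }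
  exists G. split.
  - intros x y h. pose proof (Hge x y 0%nat h). pose proof (Fm 0%nat x y h).
    pose proof (HGr x). pose proof (HGr y). lra.
  - intros i x y h1 h2 h3. eapply Rle_trans; [|apply (Hge x y i h2)].
    unfold F. rewrite !Rmin_left, !Rmax_right by lra. right. ring.
Qed.

Lemma convergents_lower (theta : R) q A p s d k : convergents theta q A p s d ->
  dnint (INR (q k) * theta) <= d k.
Proof.
  intros CV. eapply Rle_trans; [apply (dnint_le _ (p k))|].
  rewrite (cv_err _ _ _ _ _ _ CV), (sign_abs (s k)) by apply (cv_sign _ _ _ _ _ _ CV).
  pose proof (cv_pos _ _ _ _ _ _ CV k).
  replace (s k * (s k * d k)) with (d k).
  - rewrite Rabs_right; lra.
  - destruct (cv_sign _ _ _ _ _ _ CV k) as [-> | ->]; ring.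
Qed.

Lemma convergents_upper (theta : R) q A p s d k : convergents theta q A p s d ->
  INR (q (S k)) * d k <= 1.
Proof.
  intros CV. pose proof (cv_det _ _ _ _ _ _ CV k). pose proof (cv_pos _ _ _ _ _ _ CV (S k)).
  assert (0 <= INR (q k) * d (S k)) by (apply Rmult_le_pos; [apply pos_INR|lra]). lra.
Qed.

(* A covering interval of length between [d1] and [d0], fattened by [d0] and charged at
   rate [1 / (g * d1)], costs at most its own [s]-th power. *)
Lemma charge_cost (x c delta s g d0 d1 r : R) :
  1 <= x -> 0 < c -> 0 <= s -> 0 < delta -> 0 < g -> x <= g * g -> 0 < d0 -> x * d0 <= 1 ->
  c * Rpower x (- (1 + delta)) <= d1 -> d1 <= r <= d0 ->
  Rpower x (- (1 / 2 - delta - (1 + delta) * s)) <= c * Rpower c s / 3 ->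
  / (g * d1) * (r + 2 * d0) <= Rpower r s.
Proof.
  intros Hx Hc Hs Hdelta Hg Hgx Hd0 Hxd Hd1 Hr Hsmall.
  set (X := Rpower x (1 / 2)). set (Y := Rpower x (- (1 + delta))) in *.
  assert (HY : 0 < Y) by apply Rpower_pos. assert (HX : 0 < X) by apply Rpower_pos.
  assert (HXX : X * X = x).
  { unfold X. rewrite <- Rpower_plus. replace (1 / 2 + 1 / 2) with 1 by field. apply Rpower_1. lra. }
  assert (HXg : X <= g).
  { apply Rnot_lt_le. intros h. assert (g * g < X * X) by (apply Rmult_le_0_lt_compat; lra). lra. }
  assert (HcY : 0 < c * Y) by (apply Rmult_lt_0_compat; lra).
  assert (HYs : Rpower (c * Y) s <= Rpower r s) by (apply Rle_Rpower_l; lra).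
  rewrite <- Rpower_mult_distr in HYs by lra. unfold Y in HYs. rewrite Rpower_mult in HYs.
  set (Z := Rpower x (- (1 + delta) * s)) in *.
  assert (HZ : 0 < Z) by apply Rpower_pos.
  assert (HE : Rpower x (- (1 / 2 - delta - (1 + delta) * s)) * (X * x * Y * Z) = 1).
  { rewrite <- (Rpower_1 x) at 2 by lra. unfold X, Y, Z. rewrite <- !Rpower_plus.
    rewrite <- (Rpower_O x) by lra. f_equal. field. }
  set (V := Rpower x (- (1 / 2 - delta - (1 + delta) * s))) in *.
  assert (HW : 0 < X * x * Y) by (repeat apply Rmult_lt_0_compat; lra).
  eapply Rle_trans; [|exact HYs].
  assert (Hgd : X * (c * Y) <= g * d1) by (apply Rmult_le_compat; lra).
  assert (0 < X * (c * Y)) by (apply Rmult_lt_0_compat; lra).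
  apply Rle_trans with (/ (X * (c * Y)) * (3 * / x)).
  - apply Rmult_le_compat.
    + left. apply Rinv_0_lt_compat. lra.
    + lra.
    + apply Rinv_le_contravar; lra.
    + assert (d0 <= / x).
      { apply Rmult_le_reg_l with x; [lra|]. rewrite Rinv_r; lra. }
      lra.
  - apply Rmult_le_reg_r with (X * (c * Y) * x); [apply Rmult_lt_0_compat; lra|].
    replace (/ (X * (c * Y)) * (3 * / x) * (X * (c * Y) * x)) with 3 by (field; lra).
    assert (H1 : V * (X * x * Y * Z) <= c * Rpower c s / 3 * (X * x * Y * Z)).
    { apply Rmult_le_compat_r; [|exact Hsmall]. left. apply Rmult_lt_0_compat; lra. }
    rewrite HE in H1. lra.
Qed.

Lemma U_one_not_null (theta s : R) :
  0 < theta < 1 -> irrational theta -> irr_exponent_is theta 1 -> 0 <= s ->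
  hnull s (fun y => in_T y /\ U 1 theta y) -> 1 / 2 <= s.
Proof.
  intros Hth Hirr Hexp Hs Hnull. apply Rnot_lt_le. intros Hs2.
  set (delta := (1 / 2 - s) / 2). assert (Hdelta : 0 < delta) by (unfold delta; lra).
  destruct (irr_exponent_lower theta delta Hirr Hexp Hdelta) as [c [Hc Hlow]].
  (* Since [s = 1/2 - 2 delta], [beta = delta / 2 + 2 delta^2]. *)
  set (beta := 1 / 2 - delta - (1 + delta) * s).
  assert (Hbeta : 0 < beta) by (unfold beta, delta; nra).
  pose proof (Rpower_pos c s) as Hcs.
  destruct (Rpower_neg_small beta (c * Rpower c s / 3)) as [x0 [Hx1 Hx0]]; [exact Hbeta|nra|].
  destruct (convergents_exist theta Hth Hirr) as (q_ & A_ & p_ & s_ & d_ & CV_ & Hq0 & Hq1).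
  pose proof (convergents_growth _ _ _ _ _ _ CV_ ltac:(lia)) as Hgr_.
  set (m := Rmin theta (1 - theta)).
  assert (Hm : 0 < m) by (apply Rmin_glb_lt; lra).
  (* Starting at a late level makes all denominators at least [x0] and the root interval around
     [theta] short enough to stay inside [(0, 1)]. *)
  destruct (INR_unbounded (x0 + / m + 2)) as [K0 HK0].
  assert (Hm' : 0 < / m) by (apply Rinv_0_lt_compat; lra).
  assert (HK2 : (2 <= K0)%nat) by (apply INR_le; cbn [INR]; lra).
  pose proof (convergents_shift _ _ _ _ _ _ (S K0) CV_) as CV.
  set (q := fun k => q_ (k + S K0)%nat) in CV. set (A := fun k => A_ (k + S K0)%nat) in CV.
  set (p := fun k => p_ (k + S K0)%nat) in CV. set (sg := fun k => s_ (k + S K0)%nat) in CV.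
  set (d := fun k => d_ (k + S K0)%nat) in CV.
  assert (Hgr : forall k, (K0 + k <= q k)%nat /\ (q k <= q (S k))%nat).
  { intros k. unfold q. replace (k + S K0)%nat with (S (k + K0)) by lia.
    replace (S k + S K0)%nat with (S (S (k + K0))) by lia. pose proof (Hgr_ (k + K0)%nat). lia. }
  assert (Hqx : forall k, x0 <= INR (q k) /\ 1 <= INR (q k)).
  { intros k. destruct (Hgr k) as [h _]. apply le_INR in h. rewrite plus_INR in h.
    pose proof (pos_INR k). lra. }
  assert (Hd0 : d 0%nat < m).
  { pose proof (convergents_upper _ _ _ _ _ _ 0 CV) as Hu. pose proof (cv_pos _ _ _ _ _ _ CV 0) as Hp.
    destruct (Hgr 1%nat) as [h _]. apply le_INR in h. rewrite plus_INR in h. cbn [INR] in h.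
    apply Rmult_lt_reg_l with (/ m); [exact Hm'|]. rewrite Rinv_l by lra.
    assert (/ m * d 0%nat < INR (q 1%nat) * d 0%nat) by (apply Rmult_lt_compat_r; lra). lra. }
  assert (Hq01 : 2 <= INR (q 0%nat) <= INR (q 1%nat)).
  { split; [|apply le_INR; apply Hgr]. destruct (Hgr 0%nat) as [h _]. apply le_INR in h.
    rewrite plus_INR in h. cbn [INR] in h. lra. }
  (* The slack [q_1 - 1] is the largest that admits the root [n = 1]; the seeds give equality in
     [g_k^2 >= q_k]. *)
  destruct (selection_exists theta q A p sg d (INR (q 1%nat) - 1) (sqrt (INR (q 0%nat))) (sqrt (INR (q 1%nat))) CV)
    as (cc & M & g & SEL & HM0 & Hg0 & Hg1).
  { repeat split; try lra; try (apply sqrt_lt_R0; lra); try (rewrite sqrt_sqrt; lra). }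
  assert (gp : forall k, 0 < g k /\ INR (q k) <= g k * g k).
  { intros k. destruct (sel_inv _ _ _ _ _ SEL k) as (_ & h & _). lra. }
  set (eps := / (g 0%nat + g 1%nat) / 2).
  assert (Hgs : 0 < g 0%nat + g 1%nat) by (pose proof (gp 0%nat); pose proof (gp 1%nat); lra).
  assert (Heps : 0 < eps) by (apply Rdiv_lt_0_compat; [apply Rinv_0_lt_compat; lra|lra]).
  destruct (Hnull (d 0%nat) eps (cv_pos _ _ _ _ _ _ CV 0) Heps) as (a & b & Hab & Hcov & Hsum).
  (* [K i] is the scale of the interval; taking [d 0] as mesh bound ensures that one exists. *)
  assert (HK : forall i, exists K, d (S K) <= b i - a i <= d K).
  { intros i. specialize (Hab i).
    destruct (INR_unbounded (/ (b i - a i))) as [T HT].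
    assert (Hr : 0 < b i - a i) by lra.
    assert (HdT : d T <= b i - a i).
    { pose proof (convergents_upper _ _ _ _ _ _ T CV) as Hu. pose proof (cv_pos _ _ _ _ _ _ CV T) as Hp.
      destruct (Hgr (S T)) as [h _]. apply le_INR in h. rewrite plus_INR, S_INR in h.
      pose proof (pos_INR K0).
      apply Rmult_le_reg_l with (/ (b i - a i)); [apply Rinv_0_lt_compat; lra|]. rewrite Rinv_l by lra.
      apply Rle_trans with (INR (q (S T)) * d T); [apply Rmult_le_compat_r; lra|lra]. }
    clear HT. induction T as [|T IH]; [exists 0%nat; pose proof (cv_decr _ _ _ _ _ _ CV 0); lra|].
    destruct (Rle_lt_dec (d T) (b i - a i)); [apply IH; assumption|exists T; lra]. }
  apply functional_choice in HK. destruct HK as [K HK].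
  (* At this rate a length [d_(K+1)] carries mass [1 / g_(K+1)]. Fattening by [d_K] makes the
     interval contain every node of level [K] or [K + 1] that it meets. *)
  set (w := fun i => / (g (S (K i)) * d (S (K i)))).
  set (a' := fun i => a i - d (K i)). set (b' := fun i => b i + d (K i)).
  pose proof (cv_pos _ _ _ _ _ _ CV) as dpos.
  assert (Hw : forall i, 0 < w i).
  { intros i. apply Rinv_0_lt_compat, Rmult_lt_0_compat; [apply gp|apply dpos]. }
  destruct (charge_function a' b' w eps) as [G [HG HGi]].
  { intros i. unfold a', b'. specialize (Hab i). pose proof (dpos (K i)). lra. }
  { intros i. left. apply Hw. }
  { intros N. eapply Rle_trans; [|apply (Hsum N)]. apply sum_f_R0_le. intros i.
    replace (b' i - a' i) with (b i - a i + 2 * d (K i)) by (unfold a', b'; ring).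
    destruct (Hqx (S (K i))) as [hx hx1]. destruct (gp (S (K i))) as [hg hgg].
    apply (charge_cost (INR (q (S (K i)))) c delta s (g (S (K i))) (d (K i)) (d (S (K i)))); auto.
    - apply (convergents_upper _ _ _ _ _ _ _ CV).
    - eapply Rle_trans; [|apply (convergents_lower _ _ _ _ _ _ _ CV)].
      apply Hlow. apply INR_le. exact hx1.
    - left. apply Hx0. exact hx. }
  destruct (avoiding_point theta q A cc p sg d M g CV SEL G 1 theta) as (y & Hy0 & [Q0 HU] & Hy).
  { intros x y h. apply HG, h. }
  { split; [lia|split; [rewrite HM0; cbn; lra|exists 0%Z; cbn; lra]]. }
  { pose proof (dpos 0%nat) as hd0.
    assert (HR : rise sg d G 0 theta <= eps).
    { unfold rise. destruct (cv_sign _ _ _ _ _ _ CV 0) as [e|e]; rewrite e.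
      - pose proof (HG theta (theta + 1 * d 0%nat) ltac:(lra)). lra.
      - pose proof (HG (theta + -1 * d 0%nat) theta ltac:(lra)). lra. }
    apply Rle_lt_trans with (eps * (g 0%nat + g 1%nat)); [apply Rmult_le_compat_r; lra|].
    unfold eps. field_simplify; lra. }
  assert (HyT : in_T y).
  { unfold inside in Hy0. pose proof (Rmin_l theta (1 - theta)). pose proof (Rmin_r theta (1 - theta)).
    fold m in H, H0. unfold in_T.
    destruct (cv_sign _ _ _ _ _ _ CV 0) as [e|e]; rewrite e in Hy0; lra. }
  destruct (Hcov y) as [i Hi].
  { split; [exact HyT|]. exists Q0. exact HU. }
  destruct (Hy (K i)) as (k & X & Hk & Hin & Hrise).
  assert (Hdk : d (S (K i)) <= d k <= d (K i)).
  { pose proof (cv_decr _ _ _ _ _ _ CV (K i)). destruct Hk as [->| ->]; lra. }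
  assert (Hgk : g (S (K i)) <= g (S k)).
  { destruct Hk as [->| ->]; [lra|]. rewrite (sel_g _ _ _ _ _ SEL).
    destruct (sel_range _ _ _ _ _ SEL (K i)) as [hc _]. apply le_INR in hc. cbn [INR] in hc.
    pose proof (gp (K i)). pose proof (gp (S (K i))). nra. }
  (* The node lies wholly in the fattened interval, so its mass is at least [/ g (S k)], against the
     choice of the path. *)
  assert (Hbig : w i * d k <= rise sg d G k X).
  { unfold inside in Hin. unfold rise. pose proof (dpos k) as hdk.
    destruct (cv_sign _ _ _ _ _ _ CV k) as [e|e]; rewrite e in *.
    - pose proof (HGi i X (X + 1 * d k)) as h. unfold a', b' in h.
      replace (X + 1 * d k - X) with (d k) in h by ring. lra.
    - pose proof (HGi i (X + -1 * d k) X) as h. unfold a', b' in h.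
      replace (X - (X + -1 * d k)) with (d k) in h by ring. lra. }
  assert (Hwd : / g (S k) <= w i * d k).
  { apply Rle_trans with (/ g (S (K i))).
    - apply Rinv_le_contravar; [apply gp|exact Hgk].
    - apply Rle_trans with (w i * d (S (K i))).
      + unfold w. right. pose proof (gp (S (K i))). pose proof (dpos (S (K i))). field. lra.
      + apply Rmult_le_compat_l; [left; apply Hw|lra]. }
  lra.
Qed.

(** * The upper bound and the existence of the dimension *)

Lemma in_T_null (s : R) : 1 < s -> hnull s in_T.
Proof.
  intros Hs delta eps Hdelta Heps.
  destruct (Rpower_neg_small (s - 1) (eps / 2)) as [x0 [Hx1 Hx0]]; [lra|lra|].
  destruct (INR_unbounded (x0 + / delta)) as [m Hm].
  assert (Hdi : 0 < / delta) by (apply Rinv_0_lt_compat; lra).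
  assert (Hm0 : 1 <= INR m) by lra.
  assert (Hmd : / INR m <= delta).
  { rewrite <- (Rinv_inv delta). apply Rinv_le_contravar; lra. }
  assert (Hmi : 0 < / INR m) by (apply Rinv_0_lt_compat; lra).
  set (rho := Rmin (Rmin 1 delta) (eps / 4)).
  assert (Hrho : 0 < rho /\ rho <= 1 /\ rho <= delta /\ rho <= eps / 4).
  { unfold rho. pose proof (Rmin_l (Rmin 1 delta) (eps / 4)). pose proof (Rmin_r (Rmin 1 delta) (eps / 4)).
    pose proof (Rmin_l 1 delta). pose proof (Rmin_r 1 delta).
    split; [repeat apply Rmin_glb_lt; lra|lra]. }
  (* The first [m] intervals cover, at cost [m^(1-s) <= eps / 2]. Covers are infinite sequences of
     nondegenerate intervals, so a geometric tail of total length at most [2 rho <= eps / 2] is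
     appended. *)
  set (len := fun k : nat => if Nat.ltb k m then / INR m else rho * (1 / 2) ^ k).
  assert (Hpow : forall k : nat, 0 < (1 / 2) ^ k <= 1).
  { induction k as [|k IH]; cbn; lra. }
  assert (Hlen : forall k, 0 < len k <= delta).
  { intros k. unfold len. destruct (Nat.ltb k m); [lra|]. specialize (Hpow k). split; [nra|].
    assert (rho * (1 / 2) ^ k <= rho * 1) by (apply Rmult_le_compat_l; lra). lra. }
  exists (fun k => INR k * / INR m), (fun k => INR k * / INR m + len k).
  split; [intros k; specialize (Hlen k); lra|split].
  - intros x [Hx0' Hx1'].
    destruct (locate 0 (/ INR m) x m) as [i [Hi Hxi]].
    { rewrite Rinv_r by lra. lra. }
    exists i. unfold len. apply Nat.ltb_lt in Hi. rewrite Hi. lra.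
  - intros N.
    assert (Hterm : forall k, Rpower (INR k * / INR m + len k - INR k * / INR m) s <=
      (if Nat.ltb k m then / INR m * (eps / 2) else 0) + rho * (1 / 2) ^ k).
    { intros k. replace (INR k * / INR m + len k - INR k * / INR m) with (len k) by ring.
      specialize (Hpow k). unfold len. destruct (Nat.ltb k m).
      - assert (E : Rpower (/ INR m) s = / INR m * Rpower (INR m) (- (s - 1))).
        { rewrite <- (Rpower_1 (/ INR m)) at 2 by lra.
          rewrite <- (Rpower_1 (INR m)) at 1 2 by lra. rewrite <- !Rpower_Ropp, !Rpower_mult, <- Rpower_plus.
          f_equal. ring. }
        rewrite E. assert (/ INR m * Rpower (INR m) (- (s - 1)) <= / INR m * (eps / 2)).
        { apply Rmult_le_compat_l; [lra|]. left. apply Hx0. lra. }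
        assert (0 <= rho * (1 / 2) ^ k) by (apply Rmult_le_pos; lra). lra.
      - rewrite Rplus_0_l. set (l := rho * (1 / 2) ^ k).
        assert (Hl : 0 < l <= 1).
        { unfold l. split; [apply Rmult_lt_0_compat; lra|].
          assert (rho * (1 / 2) ^ k <= 1 * 1) by (apply Rmult_le_compat; lra). lra. }
        replace s with (1 + (s - 1)) by ring. rewrite Rpower_plus, Rpower_1 by lra.
        rewrite <- (Rmult_1_r l) at 3. apply Rmult_le_compat_l; [lra|].
        assert (h : Rpower l (s - 1) <= Rpower 1 (s - 1)) by (apply Rle_Rpower_l; lra).
        unfold Rpower at 2 in h. rewrite ln_1, Rmult_0_r, exp_0 in h. exact h. }
    eapply Rle_trans; [apply sum_f_R0_le, Hterm|]. rewrite sum_plus.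
    assert (H1 : sum_f_R0 (fun k => if Nat.ltb k m then / INR m * (eps / 2) else 0) N <=
      INR (Nat.min (S N) m) * (/ INR m * (eps / 2))).
    { induction N as [|N IH]; cbn [sum_f_R0].
      - destruct (Nat.ltb_spec 0 m).
        + replace (Nat.min 1 m) with 1%nat by lia. cbn [INR]. lra.
        + replace (Nat.min 1 m) with 0%nat by lia. cbn [INR]. lra.
      - destruct (Nat.ltb_spec (S N) m).
        + replace (Nat.min (S (S N)) m) with (S (Nat.min (S N) m)) by lia. rewrite S_INR. lra.
        + replace (Nat.min (S (S N)) m) with (Nat.min (S N) m) by lia. lra. }
    assert (H2 : sum_f_R0 (fun k => rho * (1 / 2) ^ k) N <= 2 * rho).
    { assert (H : forall n, sum_f_R0 (fun k => rho * (1 / 2) ^ k) n = 2 * rho - rho * (1 / 2) ^ n).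
      { induction n as [|n IH]; cbn [sum_f_R0 pow]; [ring|]. rewrite IH. field. }
      rewrite H. specialize (Hpow N). assert (0 <= rho * (1 / 2) ^ N) by (apply Rmult_le_pos; lra). lra. }
    assert (H3 : INR (Nat.min (S N) m) * (/ INR m * (eps / 2)) <= eps / 2).
    { apply Rle_trans with (INR m * (/ INR m * (eps / 2))).
      - apply Rmult_le_compat_r; [apply Rmult_le_pos; lra|]. apply le_INR. lia.
      - right. field. lra. }
    lra.
Qed.

Lemma hdim_exists (E : R -> Prop) (l u : R) :
  (forall s, 0 <= s -> hnull s E -> l <= s) ->
  0 <= u -> (forall s, u < s -> hnull s E) ->
  exists d, is_hdim E d /\ l <= d <= u.
Proof.
  intros Hl Hu0 Hu.
  (* The infimum of the exponents is taken as minus the supremum of their negatives. *)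
  destruct (completeness (fun x => 0 <= - x /\ hnull (- x) E)) as [v [Hv1 Hv2]].
  - exists (- l). intros x [h1 h2]. specialize (Hl _ h1 h2). lra.
  - exists (- (u + 1)). rewrite Ropp_involutive. split; [lra|apply Hu; lra].
  - exists (- v). split; [split|split].
    + intros s h1 h2. assert (- s <= v) by (apply Hv1; rewrite Ropp_involutive; auto). lra.
    + intros d' Hd'. assert (v <= - d').
      { apply Hv2. intros x [h1 h2]. specialize (Hd' _ h1 h2). lra. }
      lra.
    + assert (v <= - l).
      { apply Hv2. intros x [h1 h2]. specialize (Hl _ h1 h2). lra. }
      lra.
    + apply Rnot_lt_le. intros h.
      assert (- ((u + - v) / 2) <= v).
      { apply Hv1. rewrite Ropp_involutive. split; [lra|apply Hu; lra]. }
      lra.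
Qed.

Theorem theorem2 (theta : R) :
  0 < theta < 1 -> irrational theta -> irr_exponent_is theta 1 ->
  (forall tau, 0 < tau < 1 -> forall y, in_T y -> U tau theta y) /\
  (forall tau, tau > 1 -> forall y, in_T y ->
     (U tau theta y <-> exists i : nat, (1 <= i)%nat /\ y = frac (INR i * theta))) /\
  (exists d, is_hdim (fun y => in_T y /\ U 1 theta y) d /\ 1/2 <= d <= 1).
Proof.
  intros Hth Hirr Hexp. split; [|split].
  - intros tau Htau y _. apply U_full; assumption.
  - intros tau Htau y Hy. apply U_orbit; assumption.
  - apply hdim_exists.
    + intros s Hs. apply U_one_not_null; assumption.
    + lra.
    + intros s Hs delta eps Hdelta Heps.
      destruct (in_T_null s Hs delta eps Hdelta Heps) as (a & b & h1 & h2 & h3).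
      exists a, b. split; [exact h1|split; [|exact h3]]. intros x [hx _]. apply h2, hx.
Qed.
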